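(* Let $\mathbf{G}(\lambda)$ be a real-rational (possibly improper) scalar transfer function, given by a minimal centred realisation $(A,B,C,D,E)_{\lambda_0}$ of order $n=\delta(\mathbf{G})$, where $\lambda_0\in\mathbb{R}$ is not a pole of $\mathbf{G}(\lambda)$. Let $\nu$ be a positive integer with $\nu<n$, let $\alpha>0$, $n_1,\dots,n_\alpha>0$ and $\gamma\ge0$ be integers with $\sum_{i=1}^{\alpha}n_i=\nu$ and $\gamma\le\nu$, and let $\mu_1,\dots,\mu_\alpha,z_1,\dots,z_\gamma\in\overline{\mathbb{C}}\setminus\{\lambda_0\}$ be (pairwise) distinct points with $\mu_i\notin\Lambda(A-\lambda E)$ for all $i$ and $z_\ell\notin\Lambda(A-\lambda E)$ for all $\ell$. Assume that there exist $i\in\{1,\dots,\alpha\}$ and $j\in\{0,\dots,n_i-1\}$ such that $\eta_{\mathbf{G},j}(\mu_i)\neq0$. Let $S\in\mathbb{R}^{\nu\times\nu}$ be similar to $\mathrm{Jord}(\mathfrak{f}(\mu_1),n_1,\dots,\mathfrak{f}(\mu_\alpha),n_\alpha)$, let $L\in\mathbb{R}^{1\times\nu}$ be such that $(L,S)$ is observable, and let $\Pi\in\mathbb{R}^{n\times\nu}$ be the unique solution of $E\Pi+BL=(A-\lambda_0E)\Pi S$. Consider any matrix $S_z\in\mathbb{R}^{\gamma\times\gamma}$ similar to $J_z:=\mathrm{diag}(\mathfrak{f}(z_1),\dots,\mathfrak{f}(z_\gamma))$ and any vector $R_z\in\mathbb{R}^\gamma$ such that $(S_z,R_z)$ is controllable.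 Then: (a) There exists $\widehat{\Pi}\in\mathbb{R}^{\nu\times n}$ such that $\widehat{\Pi}\Pi=I_\nu$ and, for any such $\widehat{\Pi}$, there is a unique $\Upsilon_z\in\mathbb{R}^{\gamma\times n}$ solving the generalised Sylvester equation $$S_z\Upsilon_z(A-\lambda_0E)=\Upsilon_zE+R_z\big(C+DL\widehat{\Pi}\big).$$ (b) For any such $\widehat{\Pi}$ and the corresponding $\Upsilon_z$: if $\mathrm{rank}\big(\Upsilon_z(A-\lambda_0E)\Pi\big)=\gamma$ and $\Upsilon_zB=0$, and if $G\in\mathbb{R}^\nu$ satisfies $\mathfrak{f}(\mu_i)\notin\Lambda(S-GL-\lambda I_\nu)$ for all $i\in\{1,\dots,\alpha\}$ together with $$\Upsilon_z(A-\lambda_0E)\Pi G+R_zD=0,$$ then the centred realisation $$(A_m,B_m,C_m,D_m,E_m)_{\lambda_0}:=\big(I_\nu+\lambda_0(S-GL),\;G,\;C\Pi,\;D,\;S-GL\big)_{\lambda_0},$$ of the transfer function $\mathbf{H}(\lambda)=C_m(\lambda E_m-A_m)^{-1}B_m(\lambda_0-\lambda)+D_m$, satisfies $$\eta_{\mathbf{G},j}(\mu_i)=\eta_{\mathbf{H},j}(\mu_i)\quad\text{for all } i\in\{1,\dots,\alpha\},\ j\in\{0,\dots,n_i-1\}$$ and, for every $\ell\in\{1,\dots,\gamma\}$, with the system pencil $$\mathcal{S}(\lambda):=\begin{bmatrix}A_m-\lambda E_m & B_m(\lambda_0-\lambda)\\ C_m & D_m\end{bmatrix},$$ the following holds: if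 $z_\ell\in\mathbb{C}\setminus\{\lambda_0\}$, then $z_\ell\in\Lambda(\mathcal{S}(\lambda))$; if $z_\ell=\infty$, then $\mathcal{S}(\lambda)$ has an infinite generalised eigenvalue with a partial multiplicity greater than $1$.
   Context: $\overline{\mathbb{C}}:=\mathbb{C}\cup\{\infty\}$. A transfer function is a real-rational function of the complex indeterminate $\lambda$. If $\mathbf{G}=b/a$ with $a,b$ coprime real polynomials, its McMillan degree is $\delta(\mathbf{G}):=\max\{\deg a,\deg b\}$; its finite poles are the roots of $a$, and $\infty$ is a pole of $\mathbf{G}(\lambda)$ if $0$ is a pole of $\mathbf{G}(1/\lambda)$. Centred realisations: for $\lambda_0\in\mathbb{C}$, a realisation of order $n$ centred at $\lambda_0$ of $\mathbf{G}(\lambda)$, denoted $(A,B,C,D,E)_{\lambda_0}$, consists of real matrices $A,E\in\mathbb{R}^{n\times n}$, $B,C^\top\in\mathbb{R}^n$, $D\in\mathbb{R}$ with $\det(A-\lambda E)\not\equiv0$ and $\mathbf{G}(\lambda)=C(\lambda E-A)^{-1}B(\lambda_0-\lambda)+D$. (For $\lambda_0=\infty$: $\mathbf{G}(\lambda)=C(\lambda E-A)^{-1}B+D$.) A centred realisation is minimal if its order is no greater than that of any other centred realisation of the same transfer function, regardless of centring points; equivalently, if its order equals $\delta(\mathbf{G})$. For matrices $M,N$ of the same size, $\Lambda(M-\lambda N)\subseteq\overline{\mathbb{C}}$ denotes the set of generalised eigenvalues of the pencil, i.e. the points where its rank drops below its normal rank; for a square pencil with $\det(M-\lambda N)\not\equiv0$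 these are the finite roots of $\det(M-\lambda N)$, together with $\infty$ if $\det N=0$. The partial multiplicities of the infinite generalised eigenvalue are the sizes of the nilpotent Jordan blocks associated with $\infty$ in the Weierstrass/Kronecker canonical form of $M-\lambda N$ (equivalently, the partial multiplicities of the eigenvalue $0$ of the reversed pencil $\lambda M-N$). Möbius map: $\mathfrak{f}:\overline{\mathbb{C}}\to\overline{\mathbb{C}}$, $\mathfrak{f}(\lambda):=\frac{1}{\lambda-\lambda_0}$, with $\mathfrak{f}(\infty)=0$, $\mathfrak{f}(\lambda_0)=\infty$. $\mathrm{Jord}(\theta_1,n_1,\dots,\theta_q,n_q)$ denotes the block-diagonal matrix in Jordan canonical form whose Jordan block associated with $\theta_i\in\mathbb{C}$ is of size $n_i\times n_i$. Similarity is over $\mathbb{C}$. A pair $(F,R)$ with $F\in\mathbb{R}^{q\times q}$, $R\in\mathbb{R}^{q\times m}$ is controllable if $\mathrm{rank}\begin{bmatrix}R&FR&\cdots&F^{q-1}R\end{bmatrix}=q$; $(L,S)$ is observable if $(S^\top,L^\top)$ is controllable. In the stated setting the equation $E\Pi+BL=(A-\lambda_0E)\Pi S$ has a unique solution $\Pi\in\mathbb{R}^{n\times\nu}$. Moments: for $\mu\in\overline{\mathbb{C}}$ not a pole of $\mathbf{G}(\lambda)$, the $i$-th order moment of $\mathbf{G}$ at $\mu$ is $\eta_{\mathbf{G},i}(\mu):=\frac{(-1)^i}{i!}\mathbf{G}^{(i)}(\mu)$, where $\mathbf{G}^{(i)}$ is the $i$-th derivative with respect to $\lambda$; at $\mu=\infty$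 the value is understood as the limit for $\lambda\to\infty$. When $\gamma=0$ all conditions involving the points $z_\ell$ are void. *)

(* Defs.v *)
(* MathComp + MathComp-Analysis *)
From HB Require Import structures.
From mathcomp Require Import all_boot all_order all_algebra.
From mathcomp Require Import complex.
From mathcomp Require Import all_classical all_reals all_analysis.
Set Implicit Arguments.
Unset Strict Implicit.
Unset Printing Implicit Defensive.
Import Order.TTheory GRing.Theory Num.Theory.
Import numFieldNormedType.Exports.
Local Open Scope classical_set_scope.
Local Open Scope ring_scope.

(* R[i] packaged as a numClosedFieldType, so that the norm-induced topology and
   the derivative [derive1n] (here the complex derivative) apply to it. *)
Definition cplx (R : realType) : numClosedFieldType := R[i].

(* The Riemann sphere; [None] is the point at infinity. *)
Definition Cbar (R : realType) := option (cplx R).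

Definition ofR (R : realType) (x : R) : cplx R := (x%:C)%C.

Definition ofRmx (R : realType) (m n : nat) (A : 'M[R]_(m, n)) :
  'M[cplx R]_(m, n) := map_mx (real_complex R) A.

Section LinearAlgebra.
Variable F : fieldType.

(* Similarity. The first two conditions say that P and Q are mutually inverse (so that
   m = n); keeping two dimensions avoids casts. *)
Definition mx_similar (m n : nat) (A : 'M[F]_m) (B : 'M[F]_n) : Prop :=
  exists (P : 'M[F]_(m, n)) (Q : 'M[F]_(n, m)),
    [/\ P *m Q = 1%:M, Q *m P = 1%:M & A = P *m B *m Q].

Definition jordan_block (theta : F) (k : nat) : 'M[F]_k :=
  \matrix_(i, j) (theta *+ (i == j) + (j == i.+1 :> nat)%:R).

Definition Jord (q : nat) (theta : 'I_q -> F) (n_ : 'I_q -> nat) :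
  'M[F]_(\sum_i n_ i) :=
  \mxdiag_i jordan_block (theta i) (n_ i).

Definition controllable (q m : nat) (A : 'M[F]_q) (B : 'M[F]_(q, m)) : Prop :=
  \rank (\mxrow_(i < q) (A ^+ i *m B)) = q.

Definition observable (q m : nat) (C : 'M[F]_(m, q)) (A : 'M[F]_q) : Prop :=
  controllable A^T C^T.

(* A pair (M, N) stands for the pencil M - lambda N. *)

Definition pencil_mx (m n : nat) (M N : 'M[F]_(m, n)) : 'M[{poly F}]_(m, n) :=
  map_mx polyC M - 'X *: map_mx polyC N.

Definition regular_pencil (n : nat) (M N : 'M[F]_n) : Prop :=
  \det (pencil_mx M N) != 0.

(* The rank over the field of rational functions. *)
Definition normal_rank (m n : nat) (M N : 'M[F]_(m, n)) : nat :=
  \rank (map_mx (@tofrac {poly F}) (pencil_mx M N)).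

(* The value of the pencil at infinity is, up to scaling, N. *)
Definition gen_eigenvalue (m n : nat) (M N : 'M[F]_(m, n)) (z : option F) : bool :=
  if z is Some x then (\rank (M - x *: N)%R < normal_rank M N)%N
  else (\rank N < normal_rank M N)%N.

Record pencil := Pencil {
  prows : nat;
  pcols : nat;
  pconst : 'M[F]_(prows, pcols);
  plin : 'M[F]_(prows, pcols) }.

Definition pencil0 : pencil := @Pencil 0 0 0 0.

Definition pencil_dsum (p q : pencil) : pencil :=
  Pencil (block_mx (pconst p) 0 0 (pconst q)) (block_mx (plin p) 0 0 (plin q)).

(* Finite and infinite Jordan blocks, and the k x (k+1) singular block with
   -lambda on its diagonal and 1 above it, together with its transpose. *)
Definition fin_block (b : F * nat) : pencil :=
  Pencil (jordan_block b.1 b.2) 1%:M.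

Definition inf_block (k : nat) : pencil :=
  Pencil 1%:M (jordan_block 0 k).

Definition row_block (k : nat) : pencil :=
  @Pencil k k.+1 (\matrix_(i, j) (j == i.+1 :> nat)%:R)
                 (\matrix_(i, j) (j == i :> nat)%:R).

Definition col_block (k : nat) : pencil :=
  Pencil (pconst (row_block k))^T (plin (row_block k))^T.

Definition kronecker_form (fins : seq (F * nat)) (infs rows cols : seq nat) :
  pencil :=
  foldr pencil_dsum pencil0
    (map fin_block fins ++ map inf_block infs ++
     map row_block rows ++ map col_block cols).

Definition strictly_equivalent (m n : nat) (M N : 'M[F]_(m, n)) (p : pencil) :
  Prop :=
  exists (P : 'M[F]_(m, prows p)) (P' : 'M[F]_(prows p, m))
         (Q : 'M[F]_(pcols p, n)) (Q' : 'M[F]_(n, pcols p)),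
    [/\ P *m P' = 1%:M, P' *m P = 1%:M, Q *m Q' = 1%:M & Q' *m Q = 1%:M] /\
    M = P *m pconst p *m Q /\ N = P *m plin p *m Q.

(* [infs] lists the partial multiplicities of the infinite generalised
   eigenvalue, i.e. the sizes of the nilpotent Jordan blocks at infinity in the
   Kronecker canonical form over F (F is algebraically closed in every use). *)
Definition inf_partial_multiplicities (m n : nat) (M N : 'M[F]_(m, n))
    (infs : seq nat) : Prop :=
  0%N \notin infs /\
  exists (fins : seq (F * nat)) (rows cols : seq nat),
    strictly_equivalent M N (kronecker_form fins infs rows cols).

(* The Moebius map z |-> 1 / (z - l0) of the sphere. *)
Definition mobius (l0 : F) (z : option F) : option F :=
  if z is Some x then (if x == l0 then None else Some (x - l0)^-1) else Some 0.

(* Only used at points z != l0, where the Moebius map is finite. *)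
Definition mobius_val (l0 : F) (z : option F) : F := odflt 0 (mobius l0 z).

End LinearAlgebra.

(* A real-rational function, given by its reduced fraction. *)
Record transfer_function (R : realType) := TransferFunction {
  tf_num : {poly R};
  tf_den : {poly R};
  tf_den_neq0 : tf_den != 0;
  tf_coprime : coprimep tf_num tf_den }.

Section TransferFunctions.
Variable R : realType.
Implicit Types (G : transfer_function R) (z : cplx R).

Definition mcmillan_degree G : nat :=
  maxn (size (tf_num G)).-1 (size (tf_den G)).-1.

Definition tf_poly (p : {poly R}) : {poly cplx R} := map_poly (real_complex R) p.

Definition is_pole G z : bool := root (tf_poly (tf_den G)) z.

(* Meaningful away from the poles; there x / 0 = 0. *)
Definition tf_eval G z : cplx R :=
  (tf_poly (tf_num G)).[z] / (tf_poly (tf_den G)).[z].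

(* lambda |-> C (lambda E - A)^-1 B (l0 - lambda) + D, the factor
   (l0 - lambda) being absent when l0 is infinite. *)
Definition centred_tf (n : nat) (l0 : Cbar R)
    (A : 'M[R]_n) (B : 'cV[R]_n) (C : 'rV[R]_n) (D : R) (E : 'M[R]_n) :
    cplx R -> cplx R := fun z =>
  (ofRmx C *m invmx (z *: ofRmx E - ofRmx A) *m ofRmx B) ord0 ord0
    * (if l0 is Some c then c - z else 1) + ofR D.

(* Two rational functions are equal when they agree away from finitely many
   points. *)
Definition centred_realisation (n : nat) (l0 : Cbar R)
    (A : 'M[R]_n) (B : 'cV[R]_n) (C : 'rV[R]_n) (D : R) (E : 'M[R]_n) G : Prop :=
  regular_pencil A E /\
  forall z, \det (z *: ofRmx E - ofRmx A) != 0 -> ~~ is_pole G z ->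
    tf_eval G z = centred_tf l0 A B C D E z.

Definition minimal_centred_realisation (n : nat) (l0 : Cbar R)
    (A : 'M[R]_n) (B : 'cV[R]_n) (C : 'rV[R]_n) (D : R) (E : 'M[R]_n) G : Prop :=
  centred_realisation l0 A B C D E G /\
  forall (n' : nat) (l0' : Cbar R)
    (A' : 'M[R]_n') (B' : 'cV[R]_n') (C' : 'rV[R]_n') (D' : R) (E' : 'M[R]_n'),
    centred_realisation l0' A' B' C' D' E' G -> (n <= n')%N.

(* The filter of neighbourhoods of infinity in the complex plane. *)
Definition cinfty_nbhs : set_system (cplx R) :=
  [set X | exists r : R, forall z, ofR r < `|z| -> X z].

Definition moment (g : cplx R -> cplx R) (i : nat) (mu : Cbar R) : cplx R :=
  (-1) ^+ i / (i`!)%:R *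
  (if mu is Some z then derive1n i g z else lim (derive1n i g x @[x --> cinfty_nbhs])).

(* The system pencil
     [ A - lambda E   B (l0 - lambda) ]
     [      C                D        ]
   is sys_const - lambda sys_lin. *)
Definition sys_const (n : nat) (l0 : R)
    (A : 'M[R]_n) (B : 'cV[R]_n) (C : 'rV[R]_n) (D : R) : 'M[R]_(n + 1) :=
  block_mx A (l0 *: B) C D%:M.

Definition sys_lin (n : nat) (B : 'cV[R]_n) (E : 'M[R]_n) : 'M[R]_(n + 1) :=
  block_mx E B 0 0.

End TransferFunctions.

(* Main.v *)
Require Import Defs.
From HB Require Import structures.
From mathcomp Require Import all_boot all_order all_algebra.
From mathcomp Require Import complex ring zify.
From mathcomp Require Import all_classical all_reals all_analysis.
Set Implicit Arguments.
Unset Strict Implicit.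
Unset Printing Implicit Defensive.
Import Order.TTheory GRing.Theory Num.Theory.
Import numFieldNormedType.Exports.
Local Open Scope classical_set_scope.
Local Open Scope ring_scope.

(** In terms of s = lambda - lambda_0 write M1 = lambda E - A, M2 = s (S - GL) - I and
    A0 = A - lambda_0 E. The Sylvester equation for Pi says
      M1 Pi = A0 Pi (s S - I) - s B L,
    whence, with the rank-one update s S - I = M2 + s G L,
      TF - H = - s C M1^-1 (B - A0 Pi G) det (s S - I) / det M2.
    Since det (s S - I) is the product of the (s f(mu_i) - 1)^n_i, this is the
    moment matching, at infinity as well as at finite points. The same equation
    applied to adj (s S - I) x with Pi x = 0 would represent TF as a quotient of
    polynomials of degree less than nu, so Pi has full column rank.
    For Y = Uz A0 Pi one finds Sz Y = Y (S - GL) + Rz C Pi, so a left eigenvector w of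
    Sz yields a left null vector of the system pencil at z_l, or, when z_l is
    infinite, a Jordan chain of length 2 at infinity. The chain excludes a Kronecker
    form all of whose infinite blocks have size 1; that a Kronecker form exists is
    proved from Jordan chains of (M - c N)^-1 N. *)

(** * Jordan chains and the Kronecker form of a regular pencil *)

Section JordanChains.
Variable F : fieldType.

(** The nonzero moment guards against a degenerate system pencil. By the Schur complement its
    determinant is [det (A_m - y E_m) * H(y)] wherever [A_m - y E_m] is invertible; were it
    identically zero, [H] would vanish, and with it, by moment matching, all the prescribed moments
    of [TF]. Regularity makes the normal rank full, so that one nonzero left null vector lowers the
    rank, and it supplies a [c] with [M - c N] invertible. The shift by [c] is forced: [N] is always
    singular and [M] may be. The null vectors are nonzero because controllability of [(S_z, R_z)]
    gives [w R_z != 0]. Both transfer functions are treated as unreduced fractions, an adjugate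
    expression over a determinant. Identities are proved where the determinants do not vanish and
    then hold between polynomials, which yields contact orders at finite points and degree counts at
    infinity. Real data are moved to the complex numbers, where eigenvectors exist and ranks are
    unchanged. *)

Lemma jordan_blockE (th : F) k : jordan_block th k = th%:M + jordan_block 0 k.
Proof. by apply/matrixP=> i j; rewrite !mxE mul0rn add0r. Qed.

Lemma exists_entry_neq0 m n (A : 'M[F]_(m, n)) : A != 0 -> exists i j, A i j != 0.
Proof.
move=> nz; apply: contrapT => H; case/negP: nz; apply/eqP/matrixP=> i j.
by rewrite mxE; apply/eqP/negPn/negP=> ?; apply: H; exists i, j.
Qed.

Lemma mx_inverse_dim m n (P : 'M[F]_(m, n)) (Q : 'M[F]_(n, m)) :
  P *m Q = 1%:M -> Q *m P = 1%:M -> m = n.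
Proof.
by move=> PQ QP; apply/eqP; rewrite eqn_leq (mulmx1_min PQ) (mulmx1_min QP).
Qed.

(** The columns run from [B ^+ k.-1 *m v] down to [v]: in this order [B] acts on them as the
    superdiagonal shift [jordan_block 0 k]. *)
Definition right_chain n (B : 'M[F]_n) (v : 'cV[F]_n) k : 'M[F]_(n, k) :=
  \matrix_(i, j) (B ^+ (k.-1 - j) *m v) i 0.

Definition left_chain n (B : 'M[F]_n) (u : 'rV[F]_n) k : 'M[F]_(k, n) :=
  \matrix_(i, j) (u *m B ^+ i) 0 j.

Lemma mul_right_chain n (B : 'M[F]_n) v k : B ^+ k *m v = 0 ->
  B *m right_chain B v k = right_chain B v k *m jordan_block 0 k.
Proof.
move=> Bkv; apply/matrixP=> i j.
have -> : (B *m right_chain B v k) i j = (B ^+ (k.-1 - j).+1 *m v) i 0.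
  rewrite exprS -mulmxE -mulmxA !mxE; apply: eq_bigr => l _; congr (_ * _).
  by rewrite [LHS]mxE.
have k_gt0 : (0 < k)%N by case: j => j jk; apply: leq_ltn_trans jk.
rewrite [RHS]mxE; case: j => -[|j] jk /=.
  rewrite subn0 prednK // Bkv mxE big1 // => l _.
  by rewrite [jordan_block _ _ _ _]mxE mul0rn add0r mulr0.
have jk' : (j < k)%N by apply: ltnW.
rewrite (bigD1 (Ordinal jk')) //= big1 ?addr0; last first.
  move=> l; rewrite -val_eqE /= => lj.
  by rewrite [jordan_block _ _ _ _]mxE /= mul0rn add0r eqSS eq_sym (negbTE lj) mulr0.
rewrite [jordan_block _ _ _ _]mxE /= mul0rn add0r eqxx mulr1 [RHS]mxE /=.
by rewrite subnS prednK // subn_gt0 ltn_predRL.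
Qed.

Lemma mul_left_chain n (B : 'M[F]_n) u k : u *m B ^+ k = 0 ->
  left_chain B u k *m B = jordan_block 0 k *m left_chain B u k.
Proof.
move=> Bku; apply/matrixP=> i j.
have -> : (left_chain B u k *m B) i j = (u *m B ^+ i.+1) 0 j.
  rewrite exprSr -mulmxE mulmxA !mxE; apply: eq_bigr => l _; congr (_ * _).
  by rewrite [LHS]mxE.
rewrite [RHS]mxE; have [ik|ik] := ltnP i.+1 k.
  rewrite (bigD1 (Ordinal ik)) //= big1 ?addr0; last first.
    move=> l; rewrite -val_eqE /= => lj.
    by rewrite [jordan_block _ _ _ _]mxE mul0rn add0r (negbTE lj) mul0r.
  by rewrite [jordan_block _ _ _ _]mxE mul0rn add0r /= eqxx mul1r [RHS]mxE.
have ->: i.+1 = k by apply/eqP; rewrite eqn_leq ltn_ord.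
rewrite Bku mxE big1 // => l _; rewrite [jordan_block _ _ _ _]mxE mul0rn add0r.
by rewrite ltn_eqF ?mul0r // (leq_trans (ltn_ord l)).
Qed.

(** Entry [(i, j)] is [u B^(i + k - 1 - j) v], which is 0 for [i > j] and equals [u B^(k-1) v] on
    the diagonal. The transpose appears because [det_trig] expects a lower triangular matrix. *)
Lemma chain_pairing_unit n (B : 'M[F]_n) u v k :
  B ^+ k *m v = 0 -> u *m B ^+ k.-1 *m v != 0 ->
  left_chain B u k *m right_chain B v k \in unitmx.
Proof.
move=> Bkv uv.
have E i j : (left_chain B u k *m right_chain B v k) i j =
             (u *m B ^+ (i + (k.-1 - j)) *m v) 0 0.
  rewrite exprD -mulmxE !mulmxA -[in RHS]mulmxA [in RHS]mxE [in LHS]mxE.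
  by apply: eq_bigr => l _; rewrite !mxE.
have trig : is_trig_mx (left_chain B u k *m right_chain B v k)^T.
  apply/is_trig_mxP=> i j ij; rewrite [LHS]mxE E -mulmxA.
  have ->: (j + (k.-1 - i) = (j - i).-1 + k)%N.
    by have := ltn_ord j; lia.
  by rewrite exprD -mulmxE -mulmxA Bkv !mulmx0 mxE.
rewrite -unitmx_tr unitmxE det_trig // unitfE; apply/prodf_neq0 => i _.
rewrite mxE E subnKC; last by have := ltn_ord i; lia.
by apply: contra uv => /eqP uv0; apply/eqP/matrixP=> a b; rewrite !ord1 uv0 mxE.
Qed.

(** A nilpotent matrix whose index equals its size has a cyclic vector: a nonzero entry of its power
    [k.-1] picks the ends [u], [v] of a chain that fills the space. *)
Lemma full_chain_similar k (X : 'M[F]_k) (th : F) :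
  (X - th%:M) ^+ k = 0 -> (k = 0%N \/ (X - th%:M) ^+ k.-1 != 0) ->
  mx_similar X (jordan_block th k).
Proof.
move=> nil [k0|nz].
  subst k; exists 1%:M, 1%:M; split; rewrite ?mulmx1 //.
  by rewrite [LHS]flatmx0 [RHS]flatmx0.
set B := X - th%:M in nil nz *.
have [i [j Bij]] := exists_entry_neq0 nz.
pose u : 'rV[F]_k := delta_mx 0 i; pose v : 'cV[F]_k := delta_mx j 0.
have uv : u *m B ^+ k.-1 *m v != 0.
  rewrite -rowE -colE; apply: contra Bij => /eqP/matrixP/(_ 0 0).
  by rewrite !mxE => ->.
have Bkv : B ^+ k *m v = 0 by rewrite nil mul0mx.
have := chain_pairing_unit Bkv uv; rewrite unitmx_mul => /andP[_ Vu].
exists (right_chain B v k), (invmx (right_chain B v k)).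
split; rewrite ?mulmxV ?mulVmx //.
rewrite jordan_blockE mulmxDr -mul_right_chain // scalar_mxC -mulmxDl.
by rewrite [th%:M + _]addrC subrK mulmxK.
Qed.

(* The span of the right chain is complemented by the kernel of the left chain,
   and both are invariant. *)
Lemma jordan_split n (A : 'M[F]_n) (th : F) k (u : 'rV[F]_n) (v : 'cV[F]_n) :
  u *m (A - th%:M) ^+ k = 0 -> (A - th%:M) ^+ k *m v = 0 ->
  u *m (A - th%:M) ^+ k.-1 *m v != 0 ->
  exists r (A' : 'M[F]_r), mx_similar A (block_mx (jordan_block th k) 0 0 A').
Proof.
set B := A - th%:M => uB Bv uv.
have Tu := chain_pairing_unit Bv uv.
have BV := mul_right_chain Bv; have UB := mul_left_chain uB.
set U := left_chain B u k in Tu UB; set V := right_chain B v k in Tu BV.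
set J0 := jordan_block 0 k in BV UB.
pose T' := invmx (U *m V).
have T'J : T' *m J0 = J0 *m T'.
  apply: (can_inj (mulKmx Tu)); rewrite mulKVmx // mulmxA.
  have -> : U *m V *m J0 = J0 *m (U *m V) by rewrite -mulmxA -BV mulmxA UB mulmxA.
  by rewrite -mulmxA mulmxV // mulmx1.
have AV : A *m V = V *m jordan_block th k.
  by rewrite jordan_blockE mulmxDr -BV scalar_mxC -mulmxDl [th%:M + _]addrC subrK.
have UA : U *m A = jordan_block th k *m U.
  by rewrite jordan_blockE mulmxDl -UB -scalar_mxC -mulmxDr [th%:M + _]addrC subrK.
have T'Jt : T' *m jordan_block th k = jordan_block th k *m T'.
  by rewrite jordan_blockE mulmxDl mulmxDr T'J scalar_mxC.
(* [X] is the projector onto the kernel of [U] along the span of [V]. It commutes with [A] because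
   [T'] commutes with the Jordan block; a rank factorisation [Z Y] of [X] gives coordinates on the
   complement. *)
pose X := 1%:M - V *m T' *m U.
have XV : X *m V = 0.
  by rewrite mulmxBl mul1mx -!mulmxA mulVmx // mulmx1 subrr.
have UX : U *m X = 0.
  by rewrite mulmxBr mulmx1 !mulmxA mulmxV // mul1mx subrr.
have XX : X *m X = X by rewrite {2}/X mulmxBr mulmx1 !mulmxA XV !mul0mx subr0.
have XA : X *m A = A *m X.
  rewrite mulmxBl mulmxBr mul1mx mulmx1 -!mulmxA UA !mulmxA AV.
  by rewrite -[V *m T' *m _]mulmxA T'Jt !mulmxA.
have [Z [Y [Zf Yf ZY]]] : exists (Z : 'M[F]_(n, \rank X)) (Y : 'M[F]_(\rank X, n)),
    [/\ row_full Z, row_free Y & Z *m Y = X].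
  by exists (col_base X), (row_base X); split;
    [apply: col_base_full | apply: row_base_free | apply: mulmx_base].
have YZ : Y *m Z = 1%:M.
  apply: (row_full_inj Zf); apply: (row_free_inj Yf).
  by rewrite /= mulmx1 !mulmxA ZY -mulmxA ZY XX.
have UZ : U *m Z = 0.
  by apply: (row_free_inj Yf); rewrite /= mul0mx -mulmxA ZY.
have YV : Y *m V = 0.
  by rewrite -[Y *m V]mul1mx -YZ -!mulmxA [Z *m (Y *m V)]mulmxA ZY XV mulmx0.
exists (\rank X), (Y *m A *m Z), (row_mx V Z), (col_mx (T' *m U) Y); split.
- by rewrite mul_row_col ZY mulmxA /X addrC subrK.
- rewrite mul_col_row YZ YV -!mulmxA UZ mulmx0 mulVmx //.
  by rewrite -scalar_mx_block.
- rewrite mul_row_block !mulmx0 addr0 add0r mul_row_col -AV.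
  rewrite !mulmxA ZY -[X *m A *m Z *m Y]mulmxA ZY XA -[A *m X *m X]mulmxA XX.
  by rewrite -!mulmxA -mulmxDr -[X]addr0 /X !mulmxA addr0 addrC subrK mulmx1.
Qed.

End JordanChains.

(** * Kronecker forms over an algebraically closed field *)

Section KroneckerForms.
Variable F : closedFieldType.

(* With [char_poly A = g * ('X - th)^m] and [g.[th] != 0], vectors in the range of
   [g(A)] lie in the generalised eigenspace of [th]. *)
Lemma jordan_split_eigenvalue n (A : 'M[F]_n) (th : F) :
  \det (A - th%:M) = 0 ->
  exists k r (A' : 'M[F]_r),
    (0 < k)%N /\ mx_similar A (block_mx (jordan_block th k) 0 0 A').
Proof.
case: n A => [|n] A; first by rewrite det_mx00 => /eqP; rewrite oner_eq0.
move=> detA; set B := A - th%:M in detA *.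
have [m [g gth Ep]] := multiplicity_XsubC (char_poly A) th.
have {gth}gth : ~~ root g th.
  by apply: (implyP gth); apply: monic_neq0; apply: char_poly_monic.
pose gA := horner_mx A g.
have BE : horner_mx A ('X - th%:P) = B by rewrite rmorphB /= horner_mx_X horner_mx_C.
have gB : gA * B ^+ m = 0.
  by rewrite -BE -rmorphXn -rmorphM /= -Ep; apply: Cayley_Hamilton.
have cgB i : gA * B ^+ i = B ^+ i * gA.
  by rewrite -BE -rmorphXn /gA -!rmorphM /= mulrC.
have [h Eg] : exists h, g = (g.[th])%:P + h * ('X - th%:P).
  have /factor_theorem[h Eh] : root (g - (g.[th])%:P) th.
    by rewrite /root !hornerE subrr.
  by exists h; rewrite -Eh addrC subrK.
pose hA := horner_mx A h.
have gAE : gA = (g.[th])%:M + hA * B.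
  by rewrite /gA {1}Eg rmorphD rmorphM /= horner_mx_C BE.
(* A left eigenvector [w] for [th] satisfies [w g(A) = g(th) w], which is nonzero. *)
have gA0 : gA != 0.
  have /det0P[w w0 wB] : \det B == 0 by apply/eqP.
  apply: contra w0 => /eqP gA0; move: (congr1 (mulmx w) gA0).
  have -> : gA = (g.[th])%:M + B * hA.
    rewrite gAE; congr (_ + _); rewrite -BE -!rmorphM /=; congr (horner_mx A _).
    exact: mulrC.
  rewrite mulmxDr mulmx0 -mulmxE mulmxA wB mul0mx addr0 mul_mx_scalar.
  by move/eqP; rewrite scaler_eq0 -[_ == 0]/(root g th) (negbTE gth).
have exk : exists k, gA * B ^+ k == 0 by exists m; apply/eqP.
case: (ex_minnP exk) => k /eqP gBk kmin.
have k0 : (0 < k)%N.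
  rewrite lt0n; apply: contraNneq gA0 => k0.
  by move: gBk; rewrite k0 expr0 mulr1 => ->.
(* Modulo [B] the last factor [gA] is the scalar [g.[th]], and the remainder contains
   [gA * B ^+ k = 0]; what is left is nonzero by minimality of [k]. *)
have gBk1 : gA * B ^+ k.-1 * gA != 0.
  have gBp : gA * B ^+ k.-1 != 0.
    apply/negP=> /kmin; rewrite leqNgt => /negP; apply.
    by rewrite ltn_predL.
  have -> : gA * B ^+ k.-1 * gA = g.[th] *: (gA * B ^+ k.-1).
    rewrite {2}gAE mulrDr [_ * (g.[th])%:M]mul_mx_scalar.
    rewrite [X in _ + X](_ : _ = 0) ?addr0 //.
    have -> : hA * B = B * hA.
      by rewrite -BE -!rmorphM /=; congr (horner_mx A _); apply: mulrC.
    by rewrite mulrA -[gA * _ * B]mulrA -exprSr prednK // gBk mul0r.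
  by rewrite scaler_eq0 negb_or gth.
have [i [j Eij]] := exists_entry_neq0 gBk1.
have uB : delta_mx 0 i *m gA *m B ^+ k = 0 :> 'rV[F]_n.+1.
  by rewrite -mulmxA mulmxE gBk mulmx0.
have Bv : B ^+ k *m (gA *m delta_mx j 0) = 0 :> 'cV[F]_n.+1.
  by rewrite mulmxA mulmxE -cgB gBk mul0mx.
have uv : delta_mx 0 i *m gA *m B ^+ k.-1 *m (gA *m delta_mx j 0) != 0 :> 'M[F]_1.
  apply: contra Eij => /eqP/matrixP/(_ 0 0).
  by rewrite -!mulmxA -rowE !mulmxA -colE !mxE => ->.
have [r [A' E]] := jordan_split uB Bv uv.
by exists k, r, A'.
Qed.

Definition pencil_equiv (p q : pencil F) : Prop :=
  strictly_equivalent (pconst p) (plin p) q.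

Lemma strictly_equivalent_trans m n (M N : 'M[F]_(m, n)) p q :
  strictly_equivalent M N p -> pencil_equiv p q -> strictly_equivalent M N q.
Proof.
move=> [P [P' [Q [Q' [[PP' P'P QQ' Q'Q] [EM EN]]]]]].
move=> [T [T' [Y [Y' [[TT' T'T YY' Y'Y] [Ep Eq]]]]]].
exists (P *m T), (T' *m P'), (Y *m Q), (Q' *m Y'); split; first split.
- by rewrite mulmxA -[P *m T *m T']mulmxA TT' mulmx1.
- by rewrite mulmxA -[T' *m P' *m P]mulmxA P'P mulmx1.
- by rewrite mulmxA -[Y *m Q *m Q']mulmxA QQ' mulmx1.
- by rewrite mulmxA -[Q' *m Y' *m Y]mulmxA Y'Y mulmx1.
- by rewrite EM EN Ep Eq !mulmxA.
Qed.

Lemma pencil_equiv_refl p : pencil_equiv p p.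
Proof.
by exists 1%:M, 1%:M, 1%:M, 1%:M; split; rewrite ?mulmx1 ?mul1mx.
Qed.

Lemma pencil_equiv_dsum p p' q q' :
  pencil_equiv p p' -> pencil_equiv q q' ->
  pencil_equiv (pencil_dsum p q) (pencil_dsum p' q').
Proof.
move=> [P [P' [Q [Q' [[PP' P'P QQ' Q'Q] [EM EN]]]]]].
move=> [T [T' [Y [Y' [[TT' T'T YY' Y'Y] [Ep Eq]]]]]].
exists (block_mx P 0 0 T), (block_mx P' 0 0 T'), (block_mx Q 0 0 Y),
  (block_mx Q' 0 0 Y').
rewrite /pencil_dsum /= !mulmx_block !(mul0mx, mulmx0, addr0, add0r).
by rewrite PP' P'P QQ' Q'Q TT' T'T YY' Y'Y EM EN Ep Eq -!scalar_mx_block.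
Qed.

(** Pairs [(1 + c A, A)] are what [(M, N)] becomes after left multiplication by [(M - c N)^-1];
    similarity of [A] preserves this shape. *)
Lemma mx_similar_pencil m n (A : 'M[F]_m) (B : 'M[F]_n) (c : F) : mx_similar A B ->
  strictly_equivalent (1%:M + c *: A) A (Pencil (1%:M + c *: B) B).
Proof.
move=> [P [Q [PQ QP ->]]]; exists P, Q, Q, P; split=> //=; split=> //.
by rewrite mulmxDr mulmxDl mulmx1 PQ -scalemxAr -scalemxAl.
Qed.

Lemma pencil_block r k (J : 'M[F]_k) (K : 'M[F]_r) (c : F) :
  Pencil (1%:M + c *: block_mx J 0 0 K) (block_mx J 0 0 K) =
  pencil_dsum (Pencil (1%:M + c *: J) J) (Pencil (1%:M + c *: K) K).
Proof.
rewrite /pencil_dsum /=; congr (@Pencil _ _ _ _ _).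
by rewrite scale_block_mx !scaler0 (scalar_mx_block k r) add_block_mx !addr0.
Qed.

Lemma pencil_inv_const n (X Y Z : 'M[F]_n) : Z *m X = 1%:M ->
  pencil_equiv (Pencil X Y) (Pencil 1%:M (Z *m Y)).
Proof.
move=> ZX; have XZ := mulmx1C ZX.
exists X, Z, 1%:M, 1%:M; split; first by split; rewrite ?mulmx1.
by rewrite /= !mulmx1 mulmxA XZ mul1mx.
Qed.

Lemma nilpotent_kronecker n (N : 'M[F]_n) e : N ^+ e = 0 ->
  exists infs : seq nat, (0%N \notin infs) /\
    pencil_equiv (Pencil 1%:M N) (kronecker_form [::] infs [::] [::]).
Proof.
have [m] := ubnP n; elim: m n N => // m IH n N; rewrite ltnS => nm Ne.
case: n N nm Ne => [|n] N nm Ne.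
  exists [::]; split=> //; exists 1%:M, 1%:M, 1%:M, 1%:M.
  by rewrite !mulmx1; split => //=; split; apply/matrixP; case.
have detN : \det (N - 0%:M) = 0.
  rewrite raddf0 subr0; have : \det (N ^+ e) = 0.
    by rewrite Ne det0.
  have -> : \det (N ^+ e) = (\det N) ^+ e.
    elim: (e) => [|i IHi]; first by rewrite !expr0 det1.
    by rewrite !exprS -mulmxE det_mulmx IHi.
  by move/eqP; rewrite expf_eq0 => /andP[_ /eqP].
have [k [r [A' [k0 S]]]] := jordan_split_eigenvalue detN.
have [P [Q [PQ QP EN]]] := S.
have nE := mx_inverse_dim PQ QP.
have Ae : A' ^+ e = 0.
  have E i : block_mx (jordan_block 0 k) 0 0 A' ^+ i =
             block_mx (jordan_block 0 k ^+ i) 0 0 (A' ^+ i).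
    elim: i => [|i IHi]; first by rewrite !expr0 -scalar_mx_block.
    by rewrite !exprS IHi -!mulmxE mulmx_block !mulmx0 !mul0mx !addr0 add0r.
  have E2 i : Q *m (N ^+ i) *m P = block_mx (jordan_block 0 k) 0 0 A' ^+ i.
    elim: i => [|i IHi]; first by rewrite !expr0 mulmx1 QP.
    by rewrite !exprS -!mulmxE {1}EN -IHi !mulmxA QP mul1mx.
  have := E2 e; rewrite Ne mulmx0 mul0mx E => /esym/eqP.
  rewrite -[X in _ == X](@block_mx_const F k r k r 0) => /eqP/eq_block_mx[_ _ _ ->].
  by rewrite (_ : const_mx 0 = 0).
have rm : (r < m)%N by lia.
have [infs [inz Ek]] := IH _ _ rm Ae.
exists (k :: infs); split; first by rewrite inE negb_or eq_sym -lt0n k0.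
have := mx_similar_pencil 0 S; rewrite pencil_block !scale0r !addr0 => E1.
apply: strictly_equivalent_trans E1 _.
by apply: pencil_equiv_dsum Ek; apply: pencil_equiv_refl.
Qed.

Lemma expmxZ n (a : F) (Y : 'M[F]_n) e : (a *: Y) ^+ e = a ^+ e *: Y ^+ e.
Proof.
elim: e => [|e IHe]; first by rewrite !expr0 scale1r.
by rewrite !exprS IHe -!mulmxE -scalemxAl -scalemxAr scalerA.
Qed.

(** [J] is invertible, so the pencil is that of [J^-1 + c] against the identity. With [B] the shift,
    [J^-1 - th^-1 = - th^-1 J^-1 B], and as [J^-1] commutes with [B] this is nilpotent of index
    exactly [k]: there is a single block. *)
Lemma pencil_block_finite k (th c : F) : th != 0 -> (0 < k)%N ->
  pencil_equiv (Pencil (1%:M + c *: jordan_block th k) (jordan_block th k))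
               (fin_block (th^-1 + c, k)).
Proof.
move=> th0 k0; set J := jordan_block th k; set B := jordan_block 0 k : 'M[F]_k.
have JE : J = th%:M + B := jordan_blockE th k.
have Brow (i j : 'I_k) e : (B ^+ e) i j = (j == i + e :> nat)%N%:R.
  elim: e i j => [|e IHe] i j; first by rewrite expr0 mxE addn0 eq_sym.
  rewrite exprS -mulmxE mxE; have [ik|ik] := ltnP i.+1 k.
    rewrite (bigD1 (Ordinal ik)) //= big1 ?addr0; last first.
      move=> l; rewrite -val_eqE /= => lj.
      by rewrite [B _ _]mxE mul0rn add0r (negbTE lj) mul0r.
    by rewrite [B _ _]mxE mul0rn add0r /= eqxx mul1r IHe /= addnS addSn.
  rewrite big1 => [|l _]; last first.
    rewrite [B _ _]mxE mul0rn add0r ltn_eqF ?mul0r //.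
    by rewrite (leq_trans (ltn_ord l)).
  by rewrite ltn_eqF // (leq_trans (ltn_ord j)) // (leq_trans ik) // addnS ltnS leq_addr.
have Bk : B ^+ k = 0.
  by apply/matrixP=> i j; rewrite Brow mxE ltn_eqF // ltn_addl.
have Bk1 : B ^+ k.-1 != 0.
  apply/eqP=> /matrixP/(_ (Ordinal k0)).
  have k1 : (k.-1 < k)%N by rewrite ltn_predL.
  by move/(_ (Ordinal k1))/eqP; rewrite Brow mxE /= add0n eqxx oner_eq0.
have Ju : J \in unitmx.
  rewrite -unitmx_tr unitmxE det_trig.
    rewrite unitfE; apply/prodf_neq0=> i _; rewrite !mxE eqxx mulr1n.
    by rewrite ltn_eqF // addr0.
  apply/is_trig_mxP=> i j ij; rewrite !mxE.
  rewrite -val_eqE /= gtn_eqF // mulr0n add0r ltn_eqF //.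
  by rewrite (leq_trans ij).
pose X := invmx J + c%:M.
have cBJ : B *m invmx J = invmx J *m B.
  apply: (can_inj (mulKmx Ju)); rewrite mulKVmx // mulmxA.
  have -> : J *m B = B *m J by rewrite JE mulmxDl mulmxDr scalar_mxC.
  by rewrite mulmxK.
have XE : X - (th^-1 + c)%:M = (- th^-1) *: (invmx J *m B).
  apply: (can_inj (mulKmx Ju)); rewrite -scalemxAr mulKVmx //.
  rewrite /X [(_ + c)%:M]raddfD /= opprD addrACA subrr addr0 mulmxBr mulmxV // JE mulmxDl.
  rewrite -scalar_mxM mulfV // opprD addrA subrr add0r mul_mx_scalar.
  by rewrite scaleNr.
have pow e : (invmx J *m B) ^+ e = (invmx J) ^+ e *m B ^+ e.
  by rewrite mulmxE exprMn_comm //; apply/esym.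
have Xk : mx_similar X (jordan_block (th^-1 + c) k).
  apply: full_chain_similar; rewrite XE.
    rewrite expmxZ pow Bk mulmx0 scaler0 //.
  right; rewrite expmxZ scaler_eq0 negb_or expf_eq0 negb_and oppr_eq0 invr_eq0 th0 orbT.
  rewrite pow /=; apply: contra Bk1 => /eqP E0.
  have Jp e : J ^+ e *m (invmx J) ^+ e = 1%:M.
    rewrite mulmxE -exprMn_comm; last by rewrite /GRing.comm -!mulmxE mulmxV ?mulVmx.
    by rewrite -mulmxE mulmxV // expr1n.
  by rewrite -[B ^+ _]mul1mx -(Jp k.-1) -mulmxA E0 mulmx0.
have [P [Q [PQ QP EX]]] := Xk.
exists (J *m P), (Q *m invmx J), Q, P; split; first split=> //.
- by rewrite mulmxA -[J *m P *m Q]mulmxA PQ mulmx1 mulmxV.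
- by rewrite mulmxA -[Q *m invmx J *m J]mulmxA mulVmx // mulmx1.
rewrite /= mulmx1 -!mulmxA PQ mulmx1; split=> //.
by rewrite [P *m _]mulmxA -EX mulmxDr mulmxV // mul_mx_scalar.
Qed.

(** Nonzero eigenvalues [th] of [K] are split off one at a time as finite blocks at [th^-1 + c]; the
    eigenvalue 0 carries the blocks at infinity. *)
Lemma shifted_kronecker n (K : 'M[F]_n) (c : F) :
  exists (fins : seq (F * nat)) (infs : seq nat), (0%N \notin infs) /\
    pencil_equiv (Pencil (1%:M + c *: K) K) (kronecker_form fins infs [::] [::]).
Proof.
have [m] := ubnP n; elim: m n K => // m IH n K; rewrite ltnS => nm.
have [[th [th0 dth]]|nev] := pselect (exists th, th != 0 /\ \det (K - th%:M) = 0).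
  have [k [r [A' [k0 S]]]] := jordan_split_eigenvalue dth.
  have [P [Q [PQ QP EK]]] := S.
  have nE := mx_inverse_dim PQ QP.
  have rm : (r < m)%N by lia.
  have [fins [infs [inz Ek]]] := IH _ A' rm.
  exists ((th^-1 + c, k) :: fins), infs; split=> //.
  have := mx_similar_pencil c S; rewrite pencil_block => E1.
  apply: strictly_equivalent_trans E1 _.
  by apply: pencil_equiv_dsum Ek; apply: pencil_block_finite.
have Kn : K ^+ n = 0.
  case: n K nm nev => [|n] K nm nev; first by apply/matrixP; case.
  have [rs Ers] := closed_field_poly_normal (char_poly K).
  rewrite (monicP (char_poly_monic K)) scale1r in Ers.
  have rs0 : all (pred1 0) rs.
    apply/allP=> x xrs /=; apply/negPn/negP=> x0; apply: nev; exists x; split=> //.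
    have /rootP : root (char_poly K) x by rewrite Ers root_prod_XsubC.
    rewrite /char_poly -horner_evalE -det_map_mx => dx.
    have -> : K - x%:M = (-1) *: map_mx (horner_eval x) (char_poly_mx K).
      apply/matrixP=> i j; rewrite !mxE /horner_eval !hornerE.
      by case: (i == j); rewrite ?mulr1n ?mulr0n !hornerE; ring.
    by rewrite detZ dx mulr0.
  have Ec : char_poly K = 'X ^+ n.+1.
    have sz : size rs = n.+1.
      by have := size_char_poly K; rewrite Ers size_prod_XsubC => -[].
    rewrite Ers -sz; move/all_pred1P: rs0 => ->; rewrite size_nseq big_nseq.
    by rewrite subr0 -Monoid.iteropE.
  by have := Cayley_Hamilton K; rewrite Ec rmorphXn /= horner_mx_X.
(* If [1 + c K] were singular, [- c^-1] would be a nonzero eigenvalue of [K]. The inverse [Z]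
   commutes with [K], so normalising the constant part keeps the linear part nilpotent. *)
have Ku : 1%:M + c *: K \in unitmx.
  rewrite unitmxE unitfE; apply/negP=> /eqP d0.
  have c0 : c != 0.
    by apply: contra_eq_neq d0 => ->; rewrite scale0r addr0 det1 oner_eq0.
  apply: nev; exists (- c^-1); split; first by rewrite oppr_eq0 invr_eq0.
  have -> : K - (- c^-1)%:M = c^-1 *: (1%:M + c *: K).
    rewrite scalerDr scalerA mulVf // scale1r raddfN opprK addrC.
    by rewrite scale_scalar_mx mulr1.
  by rewrite detZ d0 mulr0.
pose Z := invmx (1%:M + c *: K).
have ZK : Z *m (1%:M + c *: K) = 1%:M by rewrite mulVmx.
have cZK : GRing.comm Z K.
  rewrite /GRing.comm -!mulmxE; apply: (can_inj (mulKmx Ku)).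
  rewrite !mulmxA mulmxV // mul1mx.
  have -> : (1%:M + c *: K) *m K = K *m (1%:M + c *: K).
    by rewrite mulmxDl mulmxDr mul1mx mulmx1 -scalemxAl -scalemxAr.
  by rewrite mulmxK.
have nil : (Z *m K) ^+ n = 0 by rewrite mulmxE exprMn_comm // Kn mulr0.
have [infs [inz Ek]] := nilpotent_kronecker nil.
exists [::], infs; split=> //.
by apply: strictly_equivalent_trans Ek; apply: pencil_inv_const.
Qed.

(** Absence of left Jordan chains of length 2 at infinity. Strict equivalence preserves it, so it
    can be tested on a canonical form. *)
Definition chain_free m n (M N : 'M[F]_(m, n)) : Prop :=
  forall v0 v1 : 'rV[F]_m, v0 *m N = 0 -> v1 *m N = v0 *m M -> v0 = 0.

Definition chain_free_pencil (p : pencil F) := chain_free (pconst p) (plin p).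

Lemma chain_free_equiv m n (M N : 'M[F]_(m, n)) p :
  strictly_equivalent M N p -> chain_free_pencil p -> chain_free M N.
Proof.
move=> [P [P' [Q [Q' [[PP' P'P QQ' Q'Q] [EM EN]]]]]] cf v0 v1.
rewrite EM EN !mulmxA => h0 h1.
have {}h0 : v0 *m P *m plin p = 0.
  by rewrite -[LHS]mulmx1 -QQ' mulmxA h0 mul0mx.
have {}h1 : v1 *m P *m plin p = v0 *m P *m pconst p.
  by rewrite -[LHS]mulmx1 -[RHS]mulmx1 -QQ' !mulmxA h1.
by rewrite -[v0]mulmx1 -PP' mulmxA (cf _ _ h0 h1) mul0mx.
Qed.

Lemma chain_free_dsum p q :
  chain_free_pencil p -> chain_free_pencil q -> chain_free_pencil (pencil_dsum p q).
Proof.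
move=> cp cq v0 v1 /=; rewrite -[v0]hsubmxK -[v1]hsubmxK !mul_row_block.
rewrite !mulmx0 !addr0 !add0r -row_mx0 => /eq_row_mx[a0 b0] /eq_row_mx[a1 b1].
by rewrite (cp _ _ a0 a1) (cq _ _ b0 b1) row_mx0.
Qed.

(** In a finite block the linear part is the identity, so [v0 = 0] at once; in an infinite block of
    size 1 it is 0 while the constant part is 1, and the second chain equation gives [v0 = 0]. *)
Lemma kronecker_chain_free fins infs : (forall k, k \in infs -> (k <= 1)%N) ->
  chain_free_pencil (kronecker_form fins infs [::] [::]).
Proof.
move=> H; rewrite /kronecker_form /= cats0.
elim: fins => [|[b k] fins IH] /=; last first.
  by apply: chain_free_dsum => // v0 v1 /=; rewrite mulmx1 => ->.
elim: infs H => [|k infs IH] H /=.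
  by move=> v0 v1 _ _; apply/matrixP=> ? [].
apply: chain_free_dsum; last by apply: IH => j jI; apply: H; rewrite inE jI orbT.
have : (k <= 1)%N by apply: H; rewrite inE eqxx.
case: k {H} => [|[|//]] _ v0 v1 /=; first by move=> _ _; apply/matrixP=> ? [].
have -> : jordan_block 0 1 = 0 :> 'M[F]_1.
  by apply/matrixP=> i j; rewrite !ord1 !mxE mul0rn add0r.
by rewrite !mulmx0 mulmx1 => _ <-.
Qed.

Lemma regular_pencil_infinite_chain n (M N : 'M[F]_n) (c : F) (v0 v1 : 'rV[F]_n) :
  M - c *: N \in unitmx -> v0 *m N = 0 -> v1 *m N = v0 *m M -> v0 != 0 ->
  exists infs : seq nat,
    inf_partial_multiplicities M N infs /\ exists2 k : nat, k \in infs & (1 < k)%N.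
Proof.
move=> u h0 h1 v00.
pose K := invmx (M - c *: N) *m N.
have NE : (M - c *: N) *m K = N by rewrite /K mulKVmx.
have ME : (M - c *: N) *m (1%:M + c *: K) = M.
  by rewrite mulmxDr mulmx1 -scalemxAr NE subrK.
have E0 : strictly_equivalent M N (Pencil (1%:M + c *: K) K).
  exists (M - c *: N), (invmx (M - c *: N)), 1%:M, 1%:M.
  by rewrite /= !mulmx1 NE ME mulmxV // mulVmx.
have [fins [infs [inz Ek]]] := shifted_kronecker K c.
have Ef := strictly_equivalent_trans E0 Ek.
exists infs; split; first by split=> //; exists fins, [::], [::].
apply: contrapT => H; case/eqP: v00; apply: chain_free_equiv Ef _ _ _ h0 h1.
by apply: kronecker_chain_free => k kI; rewrite leqNgt; apply/negP=> k1; apply: H; exists k.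
Qed.

End KroneckerForms.

(** * Polynomial matrices and centred realisations *)

Section PolynomialPencils.
Variable F : numFieldType.

(** In characteristic 0 a nonzero [p * q] would have more roots among the numerals than its size
    allows. *)
Lemma poly_eq0_cofinite (p q : {poly F}) :
  q != 0 -> (forall z, q.[z] != 0 -> p.[z] = 0) -> p = 0.
Proof.
move=> q0 pq; apply: contrapT => /eqP p0.
have pq0 : p * q != 0 by rewrite mulf_neq0.
pose rs := [seq i%:R : F | i <- iota 0 (size (p * q))].
have rsr : all (root (p * q)) rs.
  apply/allP=> z _; rewrite /root hornerM mulf_eq0.
  by have [//|/pq ->] := eqVneq q.[z] 0; rewrite ?eqxx ?orbT.
have rsu : uniq rs.
  rewrite map_inj_uniq ?iota_uniq // => i j /eqP.
  by rewrite eqr_nat => /eqP.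
by have := max_poly_roots pq0 rsr rsu; rewrite size_map size_iota ltnn.
Qed.

Lemma poly_ext_cofinite (p p' q : {poly F}) :
  q != 0 -> (forall z, q.[z] != 0 -> p.[z] = p'.[z]) -> p = p'.
Proof.
move=> q0 H; apply/eqP; rewrite -subr_eq0; apply/eqP.
by apply: (poly_eq0_cofinite q0) => z /H; rewrite hornerD hornerN => ->; rewrite subrr.
Qed.

Lemma coprime_fraction (a b p q : {poly F}) : coprimep a b -> b != 0 -> q != 0 ->
  a * q = b * p -> exists2 e : {poly F}, e != 0 & q = b * e /\ p = a * e.
Proof.
move=> cab b0 q0 E.
have : b %| a * q by rewrite E dvdp_mulr.
rewrite Gauss_dvdpr; last by rewrite coprimep_sym.
move=> /dvdpP[e Eq]; exists e.
  by apply: contra_neq q0 => e0; rewrite Eq e0 mul0r.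
split; first by rewrite Eq mulrC.
by apply: (mulfI b0); rewrite -E Eq; ring.
Qed.

(** Any other fraction is a common multiple of the reduced one. This sets the McMillan degree
    against a degree count in [sylvester_kernel]. *)
Lemma coprime_fraction_size (a b p q : {poly F}) : coprimep a b -> b != 0 -> q != 0 ->
  a * q = b * p -> (maxn (size a) (size b) <= maxn (size p) (size q))%N.
Proof.
move=> cab b0 q0 /(coprime_fraction cab b0 q0)[e e0 [-> ->]].
have le (c : {poly F}) : (size c <= size (c * e)%R)%N.
  have [->|c0] := eqVneq c 0; first by rewrite size_poly0.
  rewrite size_mul //; have : (0 < size e)%N by rewrite size_poly_gt0.
  by case: (size e) => // k _; rewrite addnS leq_addr.
by rewrite geq_max !leq_max !le orbT.
Qed.

Lemma size_det n (M : 'M[{poly F}]_n) :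
  (forall i j, (size (M i j) <= 2)%N) -> (size (\det M) <= n.+1)%N.
Proof.
move=> H; apply: leq_trans (size_sum _ _ _) _; apply/bigmax_leqP => s _.
rewrite mulr_sign; set p := \prod_i _.
have -> (b : bool) : size (if b then - p else p) = size p.
  by case: b; rewrite // size_polyN.
apply: leq_trans (size_poly_prod_leq _ _) _; rewrite card_ord.
set t := (\sum_i _)%N; have : (t <= \sum_(i < n) 2)%N by apply: leq_sum.
by rewrite sum_nat_const card_ord; lia.
Qed.

Lemma size_adj n (M : 'M[{poly F}]_n) i j :
  (forall i j, (size (M i j) <= 2)%N) -> (size ((\adj M) i j) <= n)%N.
Proof.
move=> H; rewrite mxE /cofactor -signr_odd.
apply: (@leq_trans (size (\det (row' j (col' i M))))).
  by case: odd; rewrite ?expr0 ?mul1r // expr1 mulN1r size_polyN.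
have n0 : (0 < n)%N by case: i => i; apply: leq_ltn_trans.
by apply: leq_trans (size_det _) _ => [a b|]; rewrite ?mxE // prednK.
Qed.

Lemma size_mulmx_const m n p r (X : 'M[F]_(m, n)) (M : 'M[{poly F}]_(n, p)) i j :
  (forall i j, (size (M i j) <= r)%N) -> (size ((map_mx polyC X *m M) i j) <= r)%N.
Proof.
move=> H; rewrite mxE; apply: leq_trans (size_sum _ _ _) _.
apply/bigmax_leqP => k _; rewrite mxE mul_polyC.
exact: leq_trans (size_scale_leq _ _) _.
Qed.

Lemma size_mulmx_constr m n p r (X : 'M[F]_(p, n)) (M : 'M[{poly F}]_(m, p)) i j :
  (forall i j, (size (M i j) <= r)%N) -> (size ((M *m map_mx polyC X) i j) <= r)%N.
Proof.
move=> H; rewrite mxE; apply: leq_trans (size_sum _ _ _) _.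
apply/bigmax_leqP => k _; rewrite mxE mulrC mul_polyC.
exact: leq_trans (size_scale_leq _ _) _.
Qed.

Definition mxeval m n (z : F) (M : 'M[{poly F}]_(m, n)) : 'M[F]_(m, n) :=
  map_mx (horner_eval z) M.

Lemma mxevalE m n (M : 'M[{poly F}]_(m, n)) z i j : (mxeval z M) i j = (M i j).[z].
Proof. by rewrite mxE. Qed.

Lemma horner_det n (M : 'M[{poly F}]_n) z : (\det M).[z] = \det (mxeval z M).
Proof. by rewrite -horner_evalE -det_map_mx. Qed.

Lemma mxeval_const m n (z : F) (A : 'M[F]_(m, n)) : mxeval z (map_mx polyC A) = A.
Proof. by apply/matrixP=> i j; rewrite !mxE /horner_eval hornerC. Qed.

Definition lpencil n (E A : 'M[F]_n) : 'M[{poly F}]_n :=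
  'X *: map_mx polyC E - map_mx polyC A.

Lemma mxeval_lpencil n (E A : 'M[F]_n) z : mxeval z (lpencil E A) = z *: E - A.
Proof.
by apply/matrixP=> i j; rewrite !mxE /horner_eval !hornerE.
Qed.

Lemma size_lpencil n (E A : 'M[F]_n) i j : (size (lpencil E A i j) <= 2)%N.
Proof.
rewrite !mxE; apply: leq_trans (size_polyD _ _) _; rewrite size_polyN geq_max.
rewrite (leq_trans (size_polyC_leq1 _)) // mulrC mul_polyC.
by rewrite (leq_trans (size_scale_leq _ _)) // size_polyX.
Qed.

(** Up to the factor [\det E] this is the characteristic polynomial of [E^-1 A]. Full degree is the
    form that regularity at infinity takes. *)
Lemma size_det_lpencil n (E A : 'M[F]_n) : E \in unitmx ->
  size (\det (lpencil E A)) = n.+1.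
Proof.
move=> uE; have -> : lpencil E A = map_mx polyC E *m char_poly_mx (invmx E *m A).
  rewrite /char_poly_mx mulmxBr -map_mxM mulKVmx // /lpencil; congr (_ - _).
  by rewrite mul_mx_scalar.
rewrite det_mulmx det_map_mx -/(char_poly _) mul_polyC size_scale.
  exact: size_char_poly.
by rewrite -unitfE -unitmxE.
Qed.

Lemma regular_pencilE n (A E : 'M[F]_n) :
  regular_pencil A E <-> \det (lpencil E A) != 0.
Proof.
rewrite /regular_pencil.
have -> : pencil_mx A E = (-1) *: lpencil E A.
  by rewrite /pencil_mx /lpencil scaleN1r opprB.
by rewrite detZ mulf_eq0 expf_eq0 oppr_eq0 oner_eq0 andbF.
Qed.

Section CentredFraction.
Variables (n : nat) (l0 : F) (A : 'M[F]_n) (B : 'cV[F]_n) (C : 'rV[F]_n) (D : F)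
  (E : 'M[F]_n).

Definition centred_den : {poly F} := \det (lpencil E A).

(** Cramer's rule puts the transfer function over [centred_den]; the fraction need not be
    reduced. *)
Definition centred_num : {poly F} :=
  (map_mx polyC C *m \adj (lpencil E A) *m map_mx polyC B) 0 0 * (l0%:P - 'X)
  + D *: centred_den.

Lemma centred_den_horner z : centred_den.[z] = \det (z *: E - A).
Proof. by rewrite horner_det mxeval_lpencil. Qed.

Lemma size_centred_den : (size centred_den <= n.+1)%N.
Proof. by apply: size_det => i j; apply: size_lpencil. Qed.

Lemma size_centred_num : (size centred_num <= n.+1)%N.
Proof.
apply: leq_trans (size_polyD _ _) _; rewrite geq_max; apply/andP; split.
  set w := (_ *m _ *m _) 0 0.
  have [n0|n0] := posnP n.
    rewrite (_ : w = 0) ?mul0r ?size_poly0 // /w mxE big1 // => i _.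
    by have := ltn_ord i; rewrite [X in (_ < X)%N]n0.
  apply: leq_trans (size_polyMleq _ _) _.
  have -> : size (l0%:P - 'X) = 2%N by rewrite -opprB size_polyN size_XsubC.
  rewrite addn2 /= ltnS; apply: size_mulmx_constr => i j.
  by apply: size_mulmx_const => k l; apply: size_adj => a b; apply: size_lpencil.
exact: leq_trans (size_scale_leq _ _) size_centred_den.
Qed.

Lemma horner_adj_lpencil (b : 'cV[F]_n) (c : 'rV[F]_n) z : centred_den.[z] != 0 ->
  ((map_mx polyC c *m \adj (lpencil E A) *m map_mx polyC b) 0 0).[z] =
  centred_den.[z] * (c *m invmx (z *: E - A) *m b) 0 0.
Proof.
move=> d0; have u : z *: E - A \in unitmx.
  by rewrite unitmxE unitfE -centred_den_horner.
have adjE : \adj (z *: E - A) = centred_den.[z] *: invmx (z *: E - A).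
  by rewrite /invmx u scalerA -centred_den_horner mulfV // ?scale1r.
rewrite -mxevalE /mxeval !map_mxM map_mx_adj -!/(mxeval _ _) !mxeval_const.
by rewrite mxeval_lpencil adjE -scalemxAr -scalemxAl mxE.
Qed.

Lemma centred_num_horner z : centred_den.[z] != 0 ->
  centred_num.[z] =
  centred_den.[z] * ((C *m invmx (z *: E - A) *m B) 0 0 * (l0 - z) + D).
Proof. by move=> d0; rewrite /centred_num !hornerE horner_adj_lpencil //; ring. Qed.

End CentredFraction.
End PolynomialPencils.

(** * Rank-one updates and the Sylvester equation *)

Section CentredRealisations.
Variable F : numFieldType.

(** The matrix determinant lemma, from two block triangular factorisations of the bordered matrix
    [X]. *)
Lemma det_rank1_update n (u : 'cV[F]_n) (v : 'rV[F]_n) :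
  \det (1%:M + u *m v) = 1 + (v *m u) 0 0.
Proof.
pose X := block_mx 1%:M u (- v) (1%:M : 'M[F]_1).
have E1 : X = block_mx 1%:M 0 (- v) 1%:M *m block_mx 1%:M u 0 (1%:M + v *m u).
  rewrite mulmx_block !(mul1mx, mul0mx, mulmx1, mulmx0, addr0, mulNmx); congr block_mx.
  by rewrite addrCA addNr addr0.
have E2 : X = block_mx (1%:M + u *m v) u 0 1%:M *m block_mx 1%:M 0 (- v) 1%:M.
  rewrite mulmx_block !(mul1mx, mul0mx, mulmx1, mulmx0, add0r, mulmxN); congr block_mx.
  by rewrite addrK.
have := det_mulmx (block_mx 1%:M 0 (- v) (1%:M : 'M[F]_1)) (block_mx 1%:M u 0 (1%:M + v *m u)).
rewrite -E1 E2 det_mulmx !det_lblock !det_ublock !det1 !mulr1 !mul1r => ->.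
by rewrite det_mx11 !mxE eqxx.
Qed.

(** At [l0] the pencil is [-1], whatever [S] is. *)
Lemma regular_det n (S : 'M[F]_n) l0 : centred_den (1%:M + l0 *: S) S != 0.
Proof.
apply/eqP=> d0; have := centred_den_horner (1%:M + l0 *: S) S l0.
rewrite d0 horner0 opprD addrCA subrr addr0 => /esym/eqP.
by rewrite -scaleN1r detZ det1 mulr1 expf_eq0 oppr_eq0 oner_eq0 andbF.
Qed.

Section Interpolation.
Variables (n nu : nat) (l0 : F) (A : 'M[F]_n) (B : 'cV[F]_n) (C : 'rV[F]_n) (D : F)
  (E : 'M[F]_n) (S : 'M[F]_nu) (L : 'rV[F]_nu) (Pi : 'M[F]_(n, nu)).
Hypothesis hPi : E *m Pi + B *m L = (A - l0 *: E) *m Pi *m S.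
Hypothesis d0 : centred_den A E != 0.

(** For [G = 0] this is the Sylvester equation rewritten at [z]; replacing [S] by [S - G L] costs a
    rank-one term that merges with [B L]. *)
Lemma sylvester_pencil (G : 'cV[F]_nu) z :
  (z *: E - A) *m Pi =
  (A - l0 *: E) *m Pi *m (z *: (S - G *m L) - (1%:M + l0 *: (S - G *m L)))
  + (l0 - z) *: ((B - (A - l0 *: E) *m Pi *m G) *m L).
Proof.
have EPi : E *m Pi = (A - l0 *: E) *m Pi *m S - B *m L by rewrite -hPi addrK.
have -> : (z *: E - A) = (z - l0) *: E - (A - l0 *: E).
  by rewrite scalerBl opprB addrA subrK.
have -> (Y : 'M[F]_nu) : z *: Y - (1%:M + l0 *: Y) = (z - l0) *: Y - 1%:M.
  by rewrite scalerBl opprD addrA addrAC.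
rewrite mulmxBl -scalemxAl EPi; set A0Pi := _ *m Pi.
rewrite mulmxBr mulmx1 -scalemxAr mulmxBr mulmxBl !mulmxA !scalerBr.
rewrite -[l0 - z]opprB !scaleNr.
apply/matrixP=> i j; rewrite !mxE; ring.
Qed.

(** With [bt = C M1^-1 b'] and [kp = L M2^-1 G], the transfer functions differ by
    [(l0 - z) bt (1 - (l0 - z) kp)]. By the determinant lemma the last factor is
    [det ((z - l0) S - 1) / det M2], so multiplying by both denominators leaves polynomials. *)
Lemma fraction_difference (G : 'cV[F]_nu) :
  let Em := S - G *m L in
  let Am := 1%:M + l0 *: Em in
  centred_num l0 A B C D E * centred_den Am Em
    - centred_num l0 Am G (C *m Pi) D Em * centred_den A E =
  (l0%:P - 'X) * (map_mx polyC C *m \adj (lpencil E A) *m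
    map_mx polyC (B - (A - l0 *: E) *m Pi *m G)) 0 0
  * centred_den (1%:M + l0 *: S) S.
Proof.
move=> Em Am; have dm0 : centred_den Am Em != 0 by apply: regular_det.
apply: (poly_ext_cofinite (mulf_neq0 d0 dm0)) => z.
rewrite hornerM mulf_eq0 negb_or => /andP[d1 d2].
set b' := B - _.
rewrite [LHS]hornerD hornerN !hornerM [(l0%:P - 'X).[z]]hornerD hornerN hornerC hornerX.
rewrite !centred_num_horner // horner_adj_lpencil //.
rewrite !centred_den_horner in d1 d2 *.
set M1 := z *: E - A in d1 *; set M2 := z *: Em - Am in d2 *.
have u1 : M1 \in unitmx by rewrite unitmxE unitfE.
have u2 : M2 \in unitmx by rewrite unitmxE unitfE.
pose bt := (C *m invmx M1 *m b') 0 0; pose kp := (L *m invmx M2 *m G) 0 0.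
have detT : \det (z *: S - (1%:M + l0 *: S)) = \det M2 * (1 - (l0 - z) * kp).
  have -> : z *: S - (1%:M + l0 *: S) =
            M2 *m (1%:M + (invmx M2 *m G) *m ((z - l0) *: L)).
    rewrite mulmxDr mulmx1 -!mulmxA mulKVmx // /M2 /Am /Em -scalemxAr.
    by apply/matrixP=> i j; rewrite !mxE; ring.
  rewrite det_mulmx det_rank1_update -scalemxAl mxE -/kp mulmxA -/kp.
  by congr (_ * _); ring.
have HPi : Pi *m invmx M2 = invmx M1 *m ((A - l0 *: E) *m Pi)
           + (l0 - z) *: (invmx M1 *m b' *m (L *m invmx M2)).
  apply: (can_inj (mulKmx u1)); rewrite mulmxDr mulKVmx // mulmxA.
  rewrite (sylvester_pencil G) -/b' -/Em -/Am -/M2 mulmxDl mulmxK //.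
  by congr (_ + _); rewrite -scalemxAr -scalemxAl -!mulmxA mulKVmx.
have HB : (C *m invmx M1 *m B) 0 0 = bt + (C *m invmx M1 *m ((A - l0 *: E) *m Pi *m G)) 0 0.
  rewrite -[in LHS](subrK ((A - l0 *: E) *m Pi *m G) B) -/b' mulmxDr.
  by rewrite [LHS]mxE.
have HG : (C *m Pi *m invmx M2 *m G) 0 0 =
          (C *m invmx M1 *m ((A - l0 *: E) *m Pi *m G)) 0 0 + (l0 - z) * (bt * kp).
  rewrite -[C *m Pi *m _]mulmxA HPi mulmxDr mulmxDl mxE; congr (_ + _).
    by rewrite !mulmxA.
  rewrite -scalemxAr -scalemxAl mxE; congr (_ * _).
  by rewrite !mulmxA -!mulmxA mulmxA [L *m _]mulmxA mulmxA mxE big_ord1.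
rewrite HB HG detT -/bt; ring.
Qed.

(* For [Pi x = 0], both sides of [TF * l = C y + D l] with [l = L adj(sS - 1) x]
   have degree below [nu], which is too small for the McMillan degree. *)
Lemma sylvester_kernel (num den : {poly F}) (x : 'cV[F]_nu) :
  coprimep num den -> den != 0 ->
  num * centred_den A E = den * centred_num l0 A B C D E ->
  (nu < maxn (size num) (size den))%N ->
  Pi *m x = 0 -> forall j, L *m S ^+ j *m x = 0.
Proof.
move=> co den0 HE snu Px.
pose T := lpencil S (1%:M + l0 *: S).
pose ell j : {poly F} := (map_mx polyC (L *m S ^+ j) *m \adj T *m map_mx polyC x) 0 0.
pose Cy : {poly F} := (map_mx polyC (C *m Pi) *m \adj T *m map_mx polyC x) 0 0.
have sT i j : (size (T i j) <= 2)%N by apply: size_lpencil.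
have evT z : mxeval z T = (z - l0) *: S - 1%:M.
  by rewrite mxeval_lpencil scalerBl opprD addrA addrAC.
have ellE z j : (ell j).[z] = (L *m S ^+ j *m (\adj ((z - l0) *: S - 1%:M) *m x)) 0 0.
  by rewrite -mxevalE /mxeval !map_mxM map_mx_adj -!/(mxeval _ _) !mxeval_const evT !mulmxA.
have CyE z : Cy.[z] = (C *m Pi *m (\adj ((z - l0) *: S - 1%:M) *m x)) 0 0.
  by rewrite -mxevalE /mxeval !map_mxM map_mx_adj -!/(mxeval _ _) !mxeval_const evT !mulmxA.
have ell0 : ell 0%N = 0.
  have key : num * ell 0%N = den * (Cy + D *: ell 0%N).
    apply: (mulIf d0); rewrite mulrAC HE -!mulrA; congr (_ * _).
    apply: (poly_ext_cofinite d0) => z dz; rewrite !hornerM.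
    rewrite [(Cy + _).[z]]hornerD hornerZ centred_num_horner //.
    rewrite CyE ellE expr0 mulmx1; set a := \adj _ *m x.
    have u1 : z *: E - A \in unitmx by rewrite unitmxE unitfE -centred_den_horner.
    (* Multiplying [a] by the pencil of [S] gives a multiple of [x], which [Pi] kills, so only the
       term in [B] survives. *)
    have M1a : (z *: E - A) *m (Pi *m a) = (l0 - z) * (L *m a) 0 0 *: B.
      have := sylvester_pencil 0 z; rewrite !mul0mx !mulmx0 !subr0 => E0.
      rewrite mulmxA E0 mulmxDl -[_ *m Pi *m _ *m a]mulmxA.
      have -> : (z *: S - (1%:M + l0 *: S)) *m a = \det ((z - l0) *: S - 1%:M) *: x.
        have -> : z *: S - (1%:M + l0 *: S) = (z - l0) *: S - 1%:M.
          by rewrite scalerBl opprD addrA addrAC.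
        by rewrite /a mulmxA mul_mx_adj mul_scalar_mx.
      rewrite -scalemxAr -[_ *m Pi *m x]mulmxA Px mulmx0 scaler0 add0r.
      rewrite -scalemxAl -mulmxA [L *m a]mx11_scalar mul_mx_scalar scalerA.
      by rewrite !mxE eqxx mulr1n.
    have -> : (C *m Pi *m a) 0 0 =
              (l0 - z) * (L *m a) 0 0 * (C *m invmx (z *: E - A) *m B) 0 0.
      rewrite -mulmxA -[Pi *m a](mulKmx u1) M1a -!scalemxAr mxE; congr (_ * _).
      by rewrite mulmxA.
    ring.
  apply/eqP; apply: contraT => ell_neq0.
  have := coprime_fraction_size co den0 ell_neq0 key.
  have sadj i j : (size ((\adj T) i j) <= nu)%N by apply: size_adj.
  have s1 : (size (ell 0%N) <= nu)%N.
    by apply: size_mulmx_constr => i j; apply: size_mulmx_const.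
  have s2 : (size (Cy + D *: ell 0%N)%R <= nu)%N.
    apply: leq_trans (size_polyD _ _) _; rewrite geq_max (leq_trans (size_scale_leq _ _)) // andbT.
    by apply: size_mulmx_constr => i j; apply: size_mulmx_const.
  by lia.
(* At [z = l0] the determinant is a sign, so [ell j = 0] gives [L S^j x = 0]; the relation then
   forces [ell j.+1 = 0], and induction from [ell 0] reaches every [j]. *)
have rec j z : (z - l0) * (ell j.+1).[z] - (ell j).[z] =
    \det ((z - l0) *: S - 1%:M) * (L *m S ^+ j *m x) 0 0.
  rewrite !ellE; set a := \adj _ *m x.
  have : ((z - l0) *: S - 1%:M) *m a = \det ((z - l0) *: S - 1%:M) *: x.
    by rewrite /a mulmxA mul_mx_adj mul_scalar_mx.
  move=> Ta; transitivity ((L *m S ^+ j *m (((z - l0) *: S - 1%:M) *m a)) 0 0).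
    rewrite mulmxBl mul1mx mulmxBr -scalemxAl -scalemxAr.
    have mx00 (a' : F) (Y Z : 'M[F]_1) : (a' *: Y - Z) 0 0 = a' * Y 0 0 - Z 0 0.
      by rewrite !mxE.
    by rewrite mx00 exprSr -mulmxE !mulmxA.
  by rewrite Ta -scalemxAr mxE.
have ellj j : ell j = 0 -> L *m S ^+ j *m x = 0 /\ ell j.+1 = 0.
  move=> ej; have Lx : L *m S ^+ j *m x = 0.
    have /esym/eqP := rec j l0; rewrite ej subrr mul0r horner0 subr0 scale0r sub0r.
    rewrite mulf_eq0 -scaleN1r detZ det1 mulr1 expf_eq0 oppr_eq0 oner_eq0 andbF /=.
    by move/eqP => H; apply/matrixP=> i k; rewrite !ord1 H mxE.
  split=> //; apply: (@poly_eq0_cofinite _ _ ('X - l0%:P)) => [|z].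
    by rewrite polyXsubC_eq0.
  rewrite !hornerE => zl0; have := rec j z; rewrite ej horner0 subr0 Lx mxE mulr0.
  by move/eqP; rewrite mulf_eq0 (negbTE zl0) => /eqP.
have all0 j : ell j = 0 by elim: j => // j IHj; case: (ellj j IHj).
by move=> j; case: (ellj j (all0 j)).
Qed.

End Interpolation.
End CentredRealisations.

(** * Derivatives and limits of rational functions *)

Section RationalDerivatives.
Variable K : numFieldType.
Implicit Types (p q : {poly K}) (f : K -> K) (x : K).

Lemma is_derive_horner p x : is_derive x 1 (horner p) p^`().[x].
Proof.
elim/poly_ind: p => [|p c IH].
  rewrite deriv0 hornerC (_ : horner 0 = cst 0); first exact: is_derive_cst.
  by apply/funext => y /=; rewrite horner0.
have -> : horner (p * 'X + c%:P) = horner p * id + cst c.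
  by apply/funext => y /=; rewrite !hornerE.
apply: is_derive_eq; rewrite derivD derivC addr0 derivM derivX !hornerE.
by rewrite /GRing.scale /= mulr1 addrC mulrC.
Qed.

Lemma continuous_horner_num p : continuous (horner p).
Proof.
move=> x; apply: differentiable_continuous; apply/derivable1_diffP.
by case: (is_derive_horner p x).
Qed.

Lemma nbhs_horner_neq0 q x : q.[x] != 0 -> \forall y \near x, q.[y] != 0.
Proof.
move=> qx; have := @continuous_horner_num q x.
move=> /cvgr_neq0; exact.
Qed.

Definition rat_deriv (pq : {poly K} * {poly K}) :=
  (pq.1^`() * pq.2 - pq.1 * pq.2^`(), pq.2 ^+ 2).

(** The guard [q] fixes a domain. Differentiation only squares denominators, so one guard serves all
    derivatives, and a product of denominators serves two functions at once. *)
Definition represents f (pq : {poly K} * {poly K}) (q : {poly K}) :=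
  forall x, q.[x] != 0 -> pq.2.[x] != 0 /\ f x = pq.1.[x] / pq.2.[x].

Lemma represents_derive1 f pq q : represents f pq q ->
  represents (derive1 f) (rat_deriv pq) q.
Proof.
move=> fE x qx; have [q2 _] := fE x qx; split; first by rewrite horner_exp expf_neq0.
rewrite derive1E; have -> : 'D_1 f x = 'D_1 (horner pq.1 * (fun y => (pq.2.[y])^-1)) x.
  apply: near_eq_derive; near=> y.
  by case: (fE y _) => //; near: y; apply: nbhs_horner_neq0.
have d1 := is_derive_horner pq.1 x; have d2 := is_derive_horner pq.2 x.
have [e1 e1'] := d1; have [e2 e2'] := d2.
rewrite deriveM //; last exact: derivableV.
have scE (b c : K) : b *: (c : K^o) = b * c by [].
by rewrite deriveV // e1' e2' !scE /= hornerD hornerN horner_exp !hornerM; field.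
Unshelve. all: by end_near.
Qed.

Lemma represents_derive1n f pq q j : represents f pq q ->
  represents (derive1n j f) (iter j rat_deriv pq) q.
Proof. by move=> fE; elim: j => // j IHj; apply: represents_derive1. Qed.

(** The difference of the two fractions is [Dl] over the product of their denominators, and the
    quotient rule for it shows that a zero of [Dl] loses at most one order. *)
Lemma rat_deriv_contact (a : K) k (pq pq' : {poly K} * {poly K}) :
  ('X - a%:P) ^+ k.+1 %| pq.1 * pq'.2 - pq'.1 * pq.2 ->
  ('X - a%:P) ^+ k %| (rat_deriv pq).1 * (rat_deriv pq').2
                      - (rat_deriv pq').1 * (rat_deriv pq).2.
Proof.
set Dl := pq.1 * pq'.2 - _ => /dvdpP[w Dw].
have -> : (rat_deriv pq).1 * (rat_deriv pq').2 - (rat_deriv pq').1 * (rat_deriv pq).2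
   = Dl^`() * (pq.2 * pq'.2) - Dl * (pq.2 * pq'.2)^`().
  rewrite /Dl /rat_deriv /= derivB !derivM; ring.
have d1 : ('X - a%:P) ^+ k %| Dl by rewrite Dw exprSr mulrA dvdp_mulr // dvdp_mulIr.
have d2 : ('X - a%:P) ^+ k %| Dl^`().
  rewrite Dw derivM deriv_exp derivB derivX derivC subr0 /= mul1r.
  rewrite dvdp_add //; first by rewrite exprSr mulrA dvdp_mulr // dvdp_mulIr.
  by rewrite -mulr_natl mulrA dvdp_mulIr.
by rewrite dvdp_sub // dvdp_mulr.
Qed.

Lemma rational_contact f g pq pq' q (a : K) k j :
  represents f pq q -> represents g pq' q -> q.[a] != 0 ->
  ('X - a%:P) ^+ k %| pq.1 * pq'.2 - pq'.1 * pq.2 -> (j < k)%N ->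
  derive1n j f a = derive1n j g a.
Proof.
move=> fE gE qa dv jk.
have dvj : ('X - a%:P) ^+ (k - j) %| (iter j rat_deriv pq).1 * (iter j rat_deriv pq').2
    - (iter j rat_deriv pq').1 * (iter j rat_deriv pq).2.
  elim: j jk => [|j IHj] jk; first by rewrite subn0.
  apply: (@rat_deriv_contact _ _ (iter j rat_deriv pq) (iter j rat_deriv pq')).
  by have jk' := ltnW jk; rewrite subnSK //; apply: IHj.
have [f2 ->] := represents_derive1n j fE qa.
have [g2 ->] := represents_derive1n j gE qa.
apply/eqP; rewrite eqr_div // -subr_eq0 -!hornerM -hornerN -hornerD.
rewrite -[_ == 0]/(root _ a) -dvdp_XsubCl; apply: dvdp_trans dvj.
by rewrite -(@subnSK j k) // exprS dvdp_mulIl.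
Qed.

Lemma size_rat_deriv (pq : {poly K} * {poly K}) : pq.2 != 0 -> (size pq.1 <= size pq.2)%N ->
  (size (rat_deriv pq).1 < size (rat_deriv pq).2)%N.
Proof.
case: pq => p q /= q0 pq.
have sq : size (q ^+ 2) = (size q + size q).-1 by rewrite expr2 size_mul.
have q1 : (0 < size q)%N by rewrite size_poly_gt0.
have [q2|q2] := leqP (size q) 1.
  rewrite (size1_polyC q2) (size1_polyC (leq_trans pq q2)) !derivC mul0r mulr0 subrr.
  by rewrite size_poly0 size_poly_gt0 expf_neq0 // -(size1_polyC q2).
have sd (r : {poly K}) : (size r^`() <= (size r).-1)%N.
  have [->|r0] := eqVneq r 0; first by rewrite deriv0 size_poly0.
  by rewrite -ltnS prednK ?size_poly_gt0 // lt_size_deriv.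
have sM (r t : {poly K}) : (size (r * t)%R <= (size r + size t).-1)%N.
  exact: size_polyMleq.
have h1 := sM p^`() q; have h2 := sM p q^`(); have h3 := sd p; have h4 := sd q.
rewrite sq; apply: leq_ltn_trans (size_polyD _ _) _; rewrite size_polyN gtn_max.
by apply/andP; split; [apply: leq_ltn_trans h1 _ | apply: leq_ltn_trans h2 _];
  move: h3 h4 pq q2 q1;
  move: (size p^`()) (size q^`()) (size p) (size q) => a b c d; lia.
Qed.

End RationalDerivatives.

(** * Limits of rational functions at infinity *)

Section MomentsAtInfinity.
Variable R : realType.
Implicit Types (p q : {poly cplx R}) (f g : cplx R -> cplx R).

Lemma cinfty_proper : ProperFilter (@cinfty_nbhs R).
Proof.
apply: Build_ProperFilter_ex.
  move=> P [r Pr]; exists (ofR (`|r| + 1)); apply: Pr.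
  have n0 : 0 <= `|r| + 1 by rewrite addr_ge0.
  have -> : `|ofR (`|r| + 1)| = ofR (`|r| + 1) :> cplx R.
    by apply: ger0_norm; rewrite /ofR (lecR 0).
  by rewrite /ofR ltcR; apply: le_lt_trans (ler_norm r) _; rewrite ltrDl.
split.
- by exists 0.
- move=> P Q [r Pr] [s Qs]; exists (Num.max r s) => z zrs; split.
    apply: Pr; apply: le_lt_trans zrs; by rewrite /ofR lecR le_max lexx.
  apply: Qs; apply: le_lt_trans zrs; by rewrite /ofR lecR le_max lexx orbT.
- by move=> P Q PQ [r Pr]; exists r => z /Pr /PQ.
Qed.

Local Existing Instance cinfty_proper.

Lemma cinfty_neq0 : \forall z \near @cinfty_nbhs R, z != 0.
Proof.
by exists 0 => z; rewrite [ofR 0](_ : _ = 0) // normr_gt0.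
Qed.

Lemma cinfty_inv : (fun z : cplx R => z^-1) @ @cinfty_nbhs R --> (0 : cplx R).
Proof.
apply/cvgrPdist_lt => e e0.
(* A positive element for the order of the complex numbers is real. *)
have eE : e = ofR (complex.Re e).
  have H (c : R[i]) : 0 < c -> c = ((complex.Re c)%:C)%C.
    by case: c => a b; rewrite ltcE /= => /andP[/eqP -> _].
  exact: H e0.
have re0 : 0 < complex.Re e by move: e0; rewrite eE /ofR ltcR.
exists (complex.Re e)^-1 => z ze.
have z0 : 0 < `|z|.
  by apply: le_lt_trans ze; rewrite /ofR (lecR 0) invr_ge0 ltW.
rewrite sub0r normrN normfV eE invf_plt ?posrE //; last by rewrite -eE.
by move: ze; rewrite /ofR fmorphV.
Qed.

(** The reversal [X^m p(1/X)] at a prescribed degree [m]: numerator and denominator are reversed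
    with the same [m], so the powers of [z] cancel. *)
Definition rev_poly (m : nat) p : {poly cplx R} := \poly_(i < m.+1) p`_(m - i).

Lemma horner_rev_poly m p z : z != 0 -> (size p <= m.+1)%N ->
  p.[z] = z ^+ m * (rev_poly m p).[z^-1].
Proof.
move=> z0 sp; rewrite (horner_coef_wide z sp) (horner_coef_wide _ (size_poly _ _)).
rewrite mulr_sumr (reindex_inj rev_ord_inj) /=; apply: eq_bigr => i _.
have im : (i <= m)%N by rewrite -ltnS.
rewrite coef_poly ltn_ord subSS mulrCA; congr (_ * _).
by rewrite exprVn exprB ?unitfE.
Qed.

Lemma rational_cvg_cinfty f p q : q != 0 -> (size p <= size q)%N ->
  (forall z, q.[z] != 0 -> f z = p.[z] / q.[z]) ->
  f @ @cinfty_nbhs R --> p`_(size q).-1 / lead_coef q.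
Proof.
move=> q0 pq fE; set m := (size q).-1.
have mE : m.+1 = size q by rewrite prednK // size_poly_gt0.
have rev0 (r : {poly cplx R}) : (rev_poly m r).[0] = r`_m.
  by rewrite horner_coef0 coef_poly subn0.
have cvrev (r : {poly cplx R}) :
    (fun z : cplx R => (rev_poly m r).[z^-1]) @ @cinfty_nbhs R --> r`_m.
  rewrite -rev0; apply: (cvg_comp _ _ cinfty_inv).
  exact: continuous_horner_num.
have lq : q`_m != 0 by rewrite -[_`_m]/(lead_coef q) lead_coef_eq0.
have cv : (fun z : cplx R => (rev_poly m p).[z^-1] / (rev_poly m q).[z^-1])
    @ @cinfty_nbhs R --> p`_m / q`_m.
  by apply: cvgM => //; apply: cvgV.
apply: cvg_trans cv; apply: near_eq_cvg.
near=> z.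
have z0 : z != 0 by near: z; apply: cinfty_neq0.
have rq : (rev_poly m q).[z^-1] != 0.
  by near: z; apply: (cvgr_neq0 _ (cvrev q)).
have Eq : q.[z] = z ^+ m * (rev_poly m q).[z^-1] by rewrite -horner_rev_poly ?mE.
rewrite fE; last by rewrite Eq mulf_neq0 // expf_neq0.
rewrite Eq (@horner_rev_poly m p) ?mE //.
by rewrite -mulf_div divff ?mul1r // expf_neq0.
Unshelve. all: by end_near.
Qed.

(** The derivatives of a fraction bounded at infinity are strictly proper and tend to 0, so only
    order 0, the ratio of top coefficients, can distinguish [f] from [g] there. *)
Lemma moment_infinity_contact f g (pq pq' : {poly cplx R} * {poly cplx R}) j :
  (forall z, pq.2.[z] != 0 -> f z = pq.1.[z] / pq.2.[z]) ->
  (forall z, pq'.2.[z] != 0 -> g z = pq'.1.[z] / pq'.2.[z]) ->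
  pq.2 != 0 -> pq'.2 != 0 ->
  (size pq.1 <= size pq.2)%N -> (size pq'.1 <= size pq'.2)%N ->
  pq.1`_(size pq.2).-1 / lead_coef pq.2 = pq'.1`_(size pq'.2).-1 / lead_coef pq'.2 ->
  moment f j None = moment g j None.
Proof.
move=> fE gE q0 q'0 s s' E; rewrite /moment; congr (_ * _).
case: j => [|j].
  rewrite (cvg_lim _ (rational_cvg_cinfty q0 s fE)) //.
  by rewrite (cvg_lim _ (rational_cvg_cinfty q'0 s' gE)).
have H (h : cplx R -> cplx R) (rt : {poly cplx R} * {poly cplx R}) :
    (forall z, rt.2.[z] != 0 -> h z = rt.1.[z] / rt.2.[z]) ->
    rt.2 != 0 -> (size rt.1 <= size rt.2)%N ->
    lim (derive1n j.+1 h x @[x --> @cinfty_nbhs R]) = 0.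
  move=> hE t0 st.
  have hr : represents h rt rt.2 by move=> z tz; split=> //; apply: hE.
  have dr := represents_derive1n j.+1 hr.
  have [Q0 sQ QE] : [/\ (iter j.+1 (@rat_deriv _) rt).2 != 0,
     (size (iter j.+1 (@rat_deriv _) rt).1 < size (iter j.+1 (@rat_deriv _) rt).2)%N &
     forall z, (iter j.+1 (@rat_deriv _) rt).2.[z] != 0 -> rt.2.[z] != 0].
    elim: (j.+1) (isT : (0 < j.+1)%N) => // i IHi _.
    have [i0|i0] := posnP i.
      rewrite i0 /=; split; [by rewrite expf_neq0| exact: size_rat_deriv|].
      by move=> z; rewrite horner_exp expf_eq0.
    have [Q0 sQ QE] := IHi i0; rewrite iterS; split.
    - by rewrite expf_neq0.
    - by apply: size_rat_deriv => //; apply: ltnW.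
    - by move=> z; rewrite horner_exp expf_eq0 /=; apply: QE.
  have dE z : (iter j.+1 (@rat_deriv _) rt).2.[z] != 0 -> derive1n j.+1 h z =
      (iter j.+1 (@rat_deriv _) rt).1.[z] / (iter j.+1 (@rat_deriv _) rt).2.[z].
    by move=> /QE /dr[].
  have := rational_cvg_cinfty Q0 (ltnW sQ) dE.
  rewrite [X in X / _]nth_default ?mul0r; first by apply: cvg_lim.
  by rewrite -ltnS prednK // (leq_ltn_trans _ sQ).
exact: etrans (H f pq fE q0 s) (esym (H g pq' gE q'0 s')).
Qed.

End MomentsAtInfinity.

(** * System zeros *)

Section MatrixFacts.
Variable F : fieldType.

Lemma det_castmx_affine m n (e : m = n) (A : 'M[F]_m) a b :
  \det (a *: castmx (e, e) A - b%:M) = \det (a *: A - b%:M).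
Proof. by case: _ / e. Qed.

Lemma det_jordan_block_affine (th : F) k a b :
  \det (a *: jordan_block th k - b%:M) = (a * th - b) ^+ k.
Proof.
rewrite -det_tr det_trig.
  rewrite (eq_bigr (fun=> a * th - b)) ?prodr_const ?card_ord // => i _.
  by rewrite !mxE eqxx !mulr1n ltn_eqF // addr0.
apply/is_trig_mxP=> i j ij; rewrite !mxE -val_eqE /= gtn_eqF // !mulr0n add0r subr0.
by rewrite ltn_eqF ?mulr0 // (leq_trans ij).
Qed.

Lemma det_Jord_affine q (th : 'I_q -> F) (n_ : 'I_q -> nat) a b :
  \det (a *: Jord th n_ - b%:M) = \prod_i (a * th i - b) ^+ n_ i.
Proof.
rewrite /Jord; elim: q th n_ => [|q IH] th n_.
  have det0 m (M : 'M[F]_m) : m = 0%N -> \det M = 1 by move=> m0; subst m; rewrite det_mx00.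
  by rewrite det0 big_ord0.
rewrite mxdiag_recl det_castmx_affine big_ord_recl.
rewrite [b%:M]scalar_mx_block scale_block_mx !scaler0 opp_block_mx add_block_mx.
by rewrite !oppr0 !addr0 det_ublock det_jordan_block_affine IH.
Qed.

Lemma det_similar_affine m n (A : 'M[F]_m) (B : 'M[F]_n) a b : mx_similar A B ->
  \det (a *: A - b%:M) = \det (a *: B - b%:M).
Proof.
move=> [P [Q [PQ QP EA]]]; have mn := mx_inverse_dim PQ QP.
subst m; have -> : a *: A - b%:M = P *m (a *: B - b%:M) *m Q.
  rewrite mulmxBr mulmxBl EA -scalemxAr -scalemxAl; congr (_ - _).
  by rewrite scalar_mxC -mulmxA PQ mulmx1.
by rewrite !det_mulmx mulrAC -det_mulmx PQ det1 mul1r.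
Qed.

Lemma det_schur m (X : 'M[F]_m) (b : 'cV[F]_m) (c : 'rV[F]_m) (d : 'M[F]_1) :
  X \in unitmx ->
  \det (block_mx X b c d) = \det X * (d - c *m invmx X *m b) 0 0.
Proof.
move=> u; have -> : block_mx X b c d =
    block_mx 1%:M 0 (c *m invmx X) 1%:M *m block_mx X b 0 (d - c *m invmx X *m b).
  rewrite mulmx_block !(mul1mx, mul0mx, mulmx1, mulmx0, addr0) mulmxKV //.
  by rewrite addrC subrK.
by rewrite det_mulmx det_lblock det_ublock !det1 !mul1r det_mx11.
Qed.

(** Vectorisation turns [f] into a square matrix with trivial kernel. *)
Lemma linear_inj_surj m n (f : {linear 'M[F]_(m, n) -> 'M[F]_(m, n)}) :
  (forall U, f U = 0 -> U = 0) -> forall Y, exists! U, f U = Y.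
Proof.
move=> inj Y.
have u : lin_mx f \in unitmx.
  rewrite -row_free_unit; apply/row_freeP.
  suff : kermx (lin_mx f) == 0 by rewrite kermx_eq0 => /row_freeP.
  apply/eqP/row_matrixP=> i; rewrite row0; set v := row i _.
  have : v *m lin_mx f = 0 by apply/sub_kermxP; apply: row_sub.
  rewrite mul_rV_lin => /(congr1 vec_mx); rewrite mxvecK linear0 => /inj /(congr1 mxvec).
  by rewrite vec_mxK linear0.
pose U := vec_mx (mxvec Y *m invmx (lin_mx f)).
have fU : f U = Y.
  by apply: (can_inj mxvecK); rewrite -mul_vec_lin /U vec_mxK mulmxKV.
exists U; split=> // V fV; apply/eqP; rewrite -subr_eq0; apply/eqP/inj.
by rewrite linearB /= fU fV subrr.
Qed.

Lemma controllable_inj q m (A : 'M[F]_q) (B : 'M[F]_(q, m)) (w : 'rV[F]_q) :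
  controllable A B -> (forall i, w *m A ^+ i *m B = 0) -> w = 0.
Proof.
move=> ctr wA; have rf : row_free (\mxrow_(i < q) (A ^+ i *m B)) by apply/eqP.
apply: (row_free_inj rf); rewrite /= mul0mx mul_mxrow.
by under eq_mxrow => i do rewrite mulmxA wA; rewrite mxrow0.
Qed.

Lemma normal_rank_regular n (M N : 'M[F]_n) : regular_pencil M N -> normal_rank M N = n.
Proof.
move=> reg; apply/mxrank_unit; rewrite unitmxE det_map_mx unitfE.
by rewrite tofrac_eq0.
Qed.

Lemma not_gen_eigenvalue_unit n (M N : 'M[F]_n) z :
  regular_pencil M N -> ~~ gen_eigenvalue M N z ->
  (if z is Some x then M - x *: N else N) \in unitmx.
Proof.
move=> reg; rewrite /gen_eigenvalue normal_rank_regular //.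
by case: z => [x|]; rewrite -leqNgt -row_full_unit /row_full eqn_leq rank_leq_row => ->.
Qed.

Lemma left_kernel_gen_eigenvalue n (M N : 'M[F]_n) x (v : 'rV[F]_n) :
  regular_pencil M N -> v != 0 -> v *m (M - x *: N) = 0 ->
  gen_eigenvalue M N (Some x).
Proof.
move=> reg v0 vM; rewrite /= normal_rank_regular // ltn_neqAle rank_leq_row andbT.
apply: contra v0 => rk; have u : M - x *: N \in unitmx by rewrite -row_free_unit.
by rewrite -[v](mulmxK u) vM mul0mx.
Qed.

(* A left eigenvector of [Sz] is turned into a left null vector of the system
   pencil at a finite point, and into a Jordan chain of length 2 at infinity. *)
Section SystemZeros.
Variables (nu gamma : nat) (Sz : 'M[F]_gamma) (Rz : 'cV[F]_gamma) (Y : 'M[F]_(gamma, nu))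
  (Em : 'M[F]_nu) (Cm : 'rV[F]_nu) (G : 'cV[F]_nu) (D l0 : F) (w : 'rV[F]_gamma).
Hypothesis SzY : Sz *m Y = Y *m Em + Rz *m Cm.
Hypothesis YG : Y *m G + D *: Rz = 0.
Let M : 'M[F]_(nu + 1) := block_mx (1%:M + l0 *: Em) (l0 *: G) Cm D%:M.
Let N : 'M[F]_(nu + 1) := block_mx Em G 0 0.

Lemma zero_left_kernel x th : (x - l0) * th = 1 -> w *m Sz = th *: w ->
  row_mx (w *m Y) (- (x - l0) *: (w *m Rz)) *m (M - x *: N) = 0.
Proof.
move=> sth wS; set s := x - l0 in sth *.
have -> : M - x *: N = block_mx (1%:M - s *: Em) (- s *: G) Cm D%:M.
  rewrite /M /N scale_block_mx opp_block_mx add_block_mx !scaler0 !oppr0 !addr0.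
  by congr block_mx; apply/matrixP=> i j; rewrite !mxE /s; ring.
(* The last entry of the row is chosen so that the terms in [Cm] cancel in the first block column;
   [YG] then cancels the second. *)
rewrite mul_row_block -row_mx0.
have wYE : w *m Y *m Em = th *: (w *m Y) - w *m Rz *m Cm.
  apply/eqP; rewrite eq_sym subr_eq eq_sym -!mulmxA -mulmxDr -SzY mulmxA wS.
  by rewrite -scalemxAl.
congr row_mx.
  rewrite mulmxBr mulmx1 -scalemxAr wYE scalerBr scalerA sth scale1r -scalemxAl.
  by rewrite opprB addrCA subrr addr0 scaleNr subrr.
have -> : w *m Y *m (- s *: G) = s *: (D *: (w *m Rz)).
  have : w *m (Y *m G + D *: Rz) = 0 by rewrite YG mulmx0.
  rewrite mulmxDr -scalemxAr => /eqP; rewrite addr_eq0 => /eqP E.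
  by rewrite -mulmxA -!scalemxAr E scaleNr scalerN opprK.
by rewrite mul_mx_scalar !scalerA mulrN scaleNr [D * s]mulrC subrr.
Qed.

Lemma infinite_zero_chain : w *m Sz = 0 ->
  let v0 := row_mx 0 (- (w *m Rz)) in let v1 := row_mx (w *m Y) 0 in
  v0 *m N = 0 /\ v1 *m N = v0 *m M.
Proof.
move=> wS v0 v1; rewrite /v0 /v1 /M /N !mul_row_block !mulmx0 !mul0mx !addr0 !add0r row_mx0.
split=> //; congr row_mx.
  have : w *m (Y *m Em + Rz *m Cm) = 0 by rewrite -SzY mulmxA wS mul0mx.
  by rewrite mulmxDr !mulmxA mulNmx => /eqP; rewrite addr_eq0 => /eqP.
have : w *m (Y *m G + D *: Rz) = 0 by rewrite YG mulmx0.
rewrite mulmxDr mulmxA -scalemxAr mul_mx_scalar scalerN => /eqP.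
by rewrite addr_eq0 => /eqP.
Qed.

End SystemZeros.

Lemma coefM_top (p q : {poly F}) m k : (size p <= m.+1)%N -> (size q <= k.+1)%N ->
  (p * q)`_(m + k) = p`_m * q`_k.
Proof.
move=> sp sq; rewrite coefM.
have mk : (m < (m + k).+1)%N by rewrite ltnS leq_addr.
rewrite (bigD1 (Ordinal mk)) //= addKn big1 ?addr0 // => i; rewrite -val_eqE /= => im.
have [ltim|leim] := ltnP i m.
  rewrite [q`__]nth_default ?mulr0 //; apply: leq_trans sq _.
  by have := ltn_ord i; lia.
rewrite [p`__]nth_default ?mul0r //; apply: leq_trans sp _.
by rewrite ltn_neqAle eq_sym im.
Qed.

End MatrixFacts.

(** * Moment matching *)

Section RealRealisations.
Variable R : realType.

Lemma ofRmxM m n p (X : 'M[R]_(m, n)) (Y : 'M[R]_(n, p)) :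
  ofRmx (X *m Y) = ofRmx X *m ofRmx Y.
Proof. exact: (map_mxM (real_complex R)). Qed.

Lemma ofRmxD m n (X Y : 'M[R]_(m, n)) : ofRmx (X + Y) = ofRmx X + ofRmx Y.
Proof. exact: (map_mxD (real_complex R)). Qed.

Lemma ofRmxB m n (X Y : 'M[R]_(m, n)) : ofRmx (X - Y) = ofRmx X - ofRmx Y.
Proof. exact: (map_mxB (real_complex R)). Qed.

Lemma ofRmxZ m n a (X : 'M[R]_(m, n)) : ofRmx (a *: X) = ofR a *: ofRmx X.
Proof. exact: (map_mxZ (real_complex R)). Qed.

Lemma ofRmx1 n : ofRmx (1%:M : 'M[R]_n) = 1%:M.
Proof. exact: (map_mx1 (real_complex R)). Qed.

Lemma ofRmx0 m n : ofRmx (0 : 'M[R]_(m, n)) = 0.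
Proof. exact: (map_mx0 (real_complex R)). Qed.

Lemma ofRmx_inj m n : injective (@ofRmx R m n).
Proof.
move=> X Y /matrixP H; apply/matrixP=> i j; have := H i j; rewrite !mxE.
exact: complexI.
Qed.

Lemma rank_ofRmx m n (X : 'M[R]_(m, n)) : \rank (ofRmx X) = \rank X.
Proof. exact: (mxrank_map (real_complex R)). Qed.

Lemma regular_pencil_ofRmx n (A E : 'M[R]_n) :
  regular_pencil A E -> regular_pencil (ofRmx A) (ofRmx E).
Proof.
rewrite /regular_pencil.
have -> : pencil_mx (ofRmx A) (ofRmx E) = map_mx (@tf_poly R) (pencil_mx A E).
  apply/matrixP=> i j; rewrite !mxE /tf_poly rmorphB rmorphM /= map_polyX !map_polyC.
  by [].
rewrite (det_map_mx (map_poly (real_complex R))) /= /tf_poly.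
by move=> h; rewrite (map_poly_eq0 (real_complex R)).
Qed.

Lemma ofRmxX n (X : 'M[R]_n) e : ofRmx (X ^+ e) = ofRmx X ^+ e.
Proof.
elim: e => [|e IHe]; first by rewrite !expr0 [LHS]ofRmx1.
by rewrite !exprS -!mulmxE ofRmxM IHe.
Qed.

Lemma controllable_ofRmx q m (A : 'M[R]_q) (B : 'M[R]_(q, m)) :
  controllable A B -> controllable (ofRmx A) (ofRmx B).
Proof.
rewrite /controllable -[in X in X -> _]rank_ofRmx => h; rewrite -[RHS]h; congr (\rank _).
have -> : ofRmx (\mxrow_(i < q) (A ^+ i *m B)) = \mxrow_(i < q) ofRmx (A ^+ i *m B).
  by apply/matrixP=> i j; rewrite !mxE.
by apply: eq_mxrow => i; rewrite ofRmxM ofRmxX.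
Qed.

Lemma observable_ofRmx nu (L : 'rV[R]_nu) (S : 'M[R]_nu) (x : 'cV[cplx R]_nu) :
  observable L S -> (forall j, ofRmx L *m ofRmx S ^+ j *m x = 0) -> x = 0.
Proof.
move=> /controllable_ofRmx obs H; apply: trmx_inj; rewrite trmx0.
apply: (controllable_inj obs) => j.
have -> : ofRmx S^T ^+ j = (ofRmx S ^+ j)^T.
  elim: j => [|j IHj]; first by rewrite !expr0 trmx1.
  rewrite exprS exprSr -!mulmxE trmx_mul IHj; congr (_ *m _).
  exact/esym/map_trmx.
have -> : ofRmx L^T = (ofRmx L)^T by apply/esym/map_trmx.
by rewrite -!trmx_mul mulmxA H trmx0.
Qed.

Lemma centred_tf_fraction n (l0 : R) (A : 'M[R]_n) B C D E z :
  (centred_den (ofRmx A) (ofRmx E)).[z] != 0 ->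
  centred_tf (Some (ofR l0)) A B C D E z =
  (centred_num (ofR l0) (ofRmx A) (ofRmx B) (ofRmx C) (ofR D) (ofRmx E)).[z] /
  (centred_den (ofRmx A) (ofRmx E)).[z].
Proof. by move=> d0; rewrite centred_num_horner // mulrAC divff // mul1r. Qed.

Lemma tf_poly_coprime (TF : transfer_function R) :
  coprimep (tf_poly (tf_num TF)) (tf_poly (tf_den TF)).
Proof.
have := tf_coprime TF; rewrite -(coprimep_map (real_complex R)).
exact.
Qed.

Lemma tf_poly_den_neq0 (TF : transfer_function R) : tf_poly (tf_den TF) != 0.
Proof. by rewrite (map_poly_eq0 (real_complex R)) tf_den_neq0. Qed.

Lemma size_tf_poly (p : {poly R}) : size (tf_poly p) = size p.
Proof. exact: (size_map_poly (real_complex R)). Qed.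

Section Realisation.
Variables (n : nat) (l0 : R) (A : 'M[R]_n) (B : 'cV[R]_n) (C : 'rV[R]_n) (D : R)
  (E : 'M[R]_n) (TF : transfer_function R).
Hypothesis hr : centred_realisation (Some (ofR l0)) A B C D E TF.
Let d := centred_den (ofRmx A) (ofRmx E).
Let p := centred_num (ofR l0) (ofRmx A) (ofRmx B) (ofRmx C) (ofR D) (ofRmx E).

Lemma realisation_den_neq0 : d != 0.
Proof. by case: hr => /regular_pencil_ofRmx/regular_pencilE. Qed.

Lemma realisation_identity : tf_poly (tf_num TF) * d = tf_poly (tf_den TF) * p.
Proof.
apply: (poly_ext_cofinite (mulf_neq0 realisation_den_neq0 (tf_poly_den_neq0 TF))) => z.
rewrite hornerM mulf_eq0 negb_or => /andP[dz denz].
case: hr => _ /(_ z); rewrite -centred_den_horner => /(_ dz denz).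
rewrite centred_tf_fraction // /tf_eval => /eqP; rewrite eqr_div // => /eqP.
by rewrite !hornerM -/d -/p => ->; rewrite mulrC.
Qed.

(** At a pole with [d.[z] != 0] the numerator would vanish together with the denominator, against
    coprimality. *)
Lemma realisation_not_pole z : d.[z] != 0 -> ~~ is_pole TF z.
Proof.
move=> dz; apply/negP => pz.
have := congr1 (horner^~ z) realisation_identity.
rewrite /= !hornerM (rootP pz) mul0r => /eqP; rewrite mulf_eq0 (negbTE dz) orbF => nz.
by have := coprimep_root (tf_poly_coprime TF) nz; rewrite (rootP pz) eqxx.
Qed.

Lemma tf_eval_fraction z : d.[z] != 0 -> tf_eval TF z = p.[z] / d.[z].
Proof.
move=> dz; case: hr => _ /(_ z); rewrite -centred_den_horner -/d => /(_ dz) ->.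
  exact: centred_tf_fraction.
exact: realisation_not_pole.
Qed.

End Realisation.

Lemma derive1n_cst0 j : derive1n j (fun _ : cplx R => 0 : cplx R) = fun=> 0.
Proof. by elim: j => //= j ->; apply/funext => x; rewrite -[RHS](derive1_cst 0 x). Qed.

Lemma moment_cst0 j (mu : Cbar R) : moment (fun=> 0) j mu = 0.
Proof.
rewrite /moment derive1n_cst0; case: mu => [x|]; first by rewrite mulr0.
have P := @cinfty_proper R.
by rewrite (_ : lim _ = 0) ?mulr0 //; apply: cvg_lim => //; apply: cvg_cst.
Qed.

Lemma size_prod_linear_factors (F : fieldType) (I : finType) (P : pred I)
    (q : I -> {poly F}) (e : I -> nat) : (forall i, size (q i) <= 2)%N ->
  (size (\prod_(i | P i) q i ^+ e i)%R <= (\sum_(i | P i) e i).+1)%N.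
Proof.
move=> sq; apply: (big_rec2 (fun (a : nat) (b : {poly F}) => (size b <= a.+1)%N)).
  by rewrite size_poly1.
move=> i a b _ sb; apply: leq_trans (size_polyMleq _ _) _.
have : (size (q i ^+ e i)%R <= (e i).+1)%N.
  apply: leq_trans (size_poly_exp_leq _ _) _; rewrite ltnS.
  by have := sq i; case: (size (q i)) => [|[|[|]]] //= _; rewrite ?mul0n ?mul1n.
by lia.
Qed.

(** Nonvanishing at infinity means that each determinant attains the degree given by the order of
    its realisation. *)
Definition regular_at (n nu : nat) (d1 d2 : {poly cplx R}) (mu : Cbar R) : Prop :=
  if mu is Some z then d1.[z] != 0 /\ d2.[z] != 0
  else size d1 = n.+1 /\ size d2 = nu.+1.

Lemma moment_contact (alpha n nu : nat) (n_ : 'I_alpha -> nat) (mu : 'I_alpha -> Cbar R)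
    (l0 : cplx R) (f g : cplx R -> cplx R) (p1 d1 p2 d2 x : {poly cplx R}) (i : 'I_alpha) j :
  (forall z, d1.[z] != 0 -> f z = p1.[z] / d1.[z]) ->
  (forall z, d2.[z] != 0 -> g z = p2.[z] / d2.[z]) ->
  p1 * d2 - p2 * d1 = (l0%:P - 'X) * x *
    \prod_i (mobius_val l0 (mu i) *: ('X - l0%:P) - 1) ^+ n_ i ->
  (\sum_i n_ i)%N = nu -> (size x <= n)%N ->
  (size p1 <= n.+1)%N -> (size p2 <= nu.+1)%N ->
  mu i <> Some l0 ->
  regular_at n nu d1 d2 (mu i) ->
  (j < n_ i)%N -> moment f j (mu i) = moment g j (mu i).
Proof.
move=> fE gE Dl sumn sx sp1 sp2 mul0 hmu jn; case Emu: (mu i) hmu mul0 => [z|] hmu mul0.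
  case: hmu => d1z d2z.
  have zl0 : z - l0 != 0 by rewrite subr_eq0; apply: contra_notN mul0 => /eqP ->.
  rewrite /moment; congr (_ * _).
  have fr : represents f (p1, d1) (d1 * d2).
    by move=> y; rewrite hornerM mulf_eq0 negb_or => /andP[dy _]; split=> //; apply: fE.
  have gr : represents g (p2, d2) (d1 * d2).
    by move=> y; rewrite hornerM mulf_eq0 negb_or => /andP[_ dy]; split=> //; apply: gE.
  have dz : (d1 * d2).[z] != 0 by rewrite hornerM mulf_neq0.
  have dv : ('X - z%:P) ^+ n_ i %| p1 * d2 - p2 * d1.
    (* For finite [z] the Moebius value is [(z - l0)^-1], so the [i]-th factor of the product
       vanishes exactly at [z]. *)
    have Ei : mobius_val l0 (mu i) *: ('X - l0%:P) - 1 = (z - l0)^-1 *: ('X - z%:P).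
      have -> : mobius_val l0 (mu i) = (z - l0)^-1.
        by rewrite Emu /mobius_val /= -[z == l0]subr_eq0 (negbTE zl0).
      have -> : 1 = (z - l0)^-1 *: (z - l0)%:P :> {poly cplx R}.
        by rewrite -mul_polyC -polyCM mulVf.
      by rewrite -scalerBr polyCB opprB addrA subrK.
    rewrite Dl; apply: dvdp_mull; rewrite (bigD1 i (erefl true)); apply: dvdp_mulr.
    have u : (z - l0)^-1 ^+ n_ i != 0 by rewrite expf_neq0 // invr_eq0.
    by rewrite Ei exprZn (dvdpZr _ _ u) dvdpp.
  exact: (rational_contact fr gr dz dv jn).
case: hmu => sd1 sd2.
have d10 : d1 != 0 by rewrite -size_poly_gt0 sd1.
have d20 : d2 != 0 by rewrite -size_poly_gt0 sd2.
apply: (@moment_infinity_contact _ f g (p1, d1) (p2, d2)) => //=; rewrite ?sd1 ?sd2 //.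
set q := fun i => mobius_val l0 (mu i) *: ('X - l0%:P) - 1 in Dl.
have sq k : (size (q k) <= 2)%N.
  apply: leq_trans (size_polyD _ _) _; rewrite size_polyN size_poly1 geq_max andbT.
  by apply: leq_trans (size_scale_leq _ _) _; rewrite size_XsubC.
(* At infinity the Moebius value is 0: the [i]-th factor is the constant [-1], and the product loses
   [n_ i >= 1] degrees. *)
have sprod : (size (\prod_i q i ^+ n_ i)%R <= nu)%N.
  have -> : \prod_i q i ^+ n_ i = (-1) ^+ n_ i * \prod_(k | k != i) q k ^+ n_ k.
    by rewrite (bigD1 i) //= {1}/q Emu /= scale0r sub0r.
  have := size_prod_linear_factors (fun k => k != i) n_ sq.
  set t := \prod_(k | _) _ => st; rewrite -signr_odd mulr_sign.
  have -> (b : bool) : size (if b then - t else t) = size t.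
    by case: b; rewrite // size_polyN.
  have Es : (nu = n_ i + \sum_(k | k != i) n_ k)%N by rewrite -sumn (bigD1 i).
  have ni : (0 < n_ i)%N by apply: leq_ltn_trans jn.
  apply: leq_trans st _; rewrite Es.
  by move: ni; case: (n_ i) => // k _; rewrite addSn ltnS leq_addl.
(* The cross difference has degree below [n + nu], so its coefficient there vanishes and the ratios
   of leading coefficients agree. *)
have topE : p1`_n * d2`_nu = p2`_nu * d1`_n.
  apply/eqP; rewrite -subr_eq0 -coefM_top ?sd2 // -coefM_top ?sd1 // [(nu + n)%N]addnC.
  rewrite -coefB Dl nth_default //.
  apply: leq_trans (size_polyMleq _ _) _.
  have s1 : (size ((l0%:P - 'X) * x)%R <= n.+1)%N.
    apply: leq_trans (size_polyMleq _ _) _.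
    have -> : size (l0%:P - 'X : {poly cplx R}) = 2%N.
      by rewrite -opprB size_polyN size_XsubC.
    by rewrite add2n /= ltnS.
  rewrite -subn1 leq_subLR addnA add1n.
  exact: leq_add.
rewrite /lead_coef sd1 sd2 /=; apply/eqP; rewrite eqr_div.
- exact/eqP.
- by have := d10; rewrite -lead_coef_eq0 /lead_coef sd1.
- by have := d20; rewrite -lead_coef_eq0 /lead_coef sd2.
Qed.

(** [g] is known only off the roots of [d]; comparing it with the fraction [0 / d] settles
    derivatives and limits as well. *)
Lemma moment_num0 n (d : {poly cplx R}) (g : cplx R -> cplx R) (mu : Cbar R) j :
  (forall z, d.[z] != 0 -> g z = 0) ->
  (if mu is Some z then d.[z] != 0 else size d == n.+1) -> moment g j mu = 0.
Proof.
move=> gE hmu; rewrite -[RHS](moment_cst0 j mu); case: mu hmu => [z|] hmu.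
  rewrite /moment; congr (_ * _).
  have gr : represents g (0, d) d by move=> y dy; rewrite gE // horner0 mul0r.
  have zr : represents (fun=> 0) (0, d) d by move=> y dy; rewrite horner0 mul0r.
  have dv : ('X - z%:P) ^+ j.+1 %| (0 * d - 0 * d : {poly cplx R}).
    by rewrite subrr dvdp0.
  exact: (rational_contact gr zr hmu dv (ltnSn j)).
have d0 : d != 0 by rewrite -size_poly_gt0 (eqP hmu).
have gr y : d.[y] != 0 -> g y = (0 : {poly cplx R}).[y] / d.[y].
  by move=> /gE ->; rewrite horner0 mul0r.
have zr y : d.[y] != 0 -> 0 = (0 : {poly cplx R}).[y] / d.[y].
  by rewrite horner0 mul0r.
have s0 : (size (0%R : {poly cplx R}) <= size d)%N by rewrite size_poly0.
exact: (@moment_infinity_contact _ g _ (0, d) (0, d) j gr zr d0 d0 s0 s0 erefl).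
Qed.

End RealRealisations.

(** * Left eigenvectors, controllability and the signal generator *)

Section FinalFacts.

Lemma row_full_of_inj (F : fieldType) m n (X : 'M[F]_(m, n)) :
  (forall x : 'cV[F]_n, X *m x = 0 -> x = 0) -> row_full X.
Proof.
move=> H; rewrite /row_full -mxrank_tr -/(row_free _) -kermx_eq0.
apply/eqP/row_matrixP=> i; rewrite row0; set v := row i _.
have : v *m X^T = 0 by apply/sub_kermxP; apply: row_sub.
move/(congr1 trmx); rewrite trmx_mul trmxK trmx0 => /H /(congr1 trmx).
by rewrite trmxK trmx0.
Qed.

Lemma similar_diag_left_eigenvectors (F : fieldType) m (S : 'M[F]_m) (th : 'rV[F]_m) :
  mx_similar S (diag_mx th) ->
  exists2 Q : 'M[F]_m, Q \in unitmx & forall l, row l Q *m S = th 0 l *: row l Q.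
Proof.
move=> [P [Q [PQ QP ES]]]; exists Q; first by case: (mulmx1_unit QP).
move=> l; rewrite -row_mul ES !mulmxA QP mul1mx.
by apply/rowP => j; rewrite mul_diag_mx !mxE.
Qed.

Lemma row_unitmx_neq0 (F : fieldType) m (Q : 'M[F]_m) l : Q \in unitmx -> row l Q != 0.
Proof.
move=> Qu; apply/eqP=> /(congr1 (mulmx^~ (invmx Q))) /=.
rewrite -row_mul mulmxV // mul0mx => /matrixP/(_ 0 l); rewrite !mxE eqxx => /eqP.
by rewrite oner_eq0.
Qed.

(** The Hautus test: if [w Rz = 0], every [w S^i Rz = th^i w Rz] vanishes, and controllability
    forces [w = 0]. *)
Lemma eigenvector_input_neq0 (F : fieldType) m (S : 'M[F]_m) (Rz : 'cV[F]_m)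
    (w : 'rV[F]_m) th :
  controllable S Rz -> w *m S = th *: w -> w != 0 -> w *m Rz != 0.
Proof.
move=> ctr wS; apply: contra => /eqP wR; apply/eqP/(controllable_inj ctr) => i.
have -> : w *m S ^+ i = th ^+ i *: w.
  elim: i => [|i IHi]; first by rewrite !expr0 mulmx1 scale1r.
  by rewrite exprSr -mulmxE mulmxA IHi -scalemxAl wS scalerA exprSr.
by rewrite -scalemxAl wR scaler0.
Qed.

Lemma signal_den_prod (F : numFieldType) nu alpha (S : 'M[F]_nu) (l0 : F)
    (th : 'I_alpha -> F) (n_ : 'I_alpha -> nat) :
  mx_similar S (Jord th n_) ->
  centred_den (1%:M + l0 *: S) S = \prod_i (th i *: ('X - l0%:P) - 1) ^+ n_ i.
Proof.
move=> hS; apply: (@poly_ext_cofinite _ _ _ 1); first exact: oner_neq0.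
move=> z _; rewrite centred_den_horner.
have -> : z *: S - (1%:M + l0 *: S) = (z - l0) *: S - 1%:M.
  by rewrite scalerBl opprD addrA addrAC.
rewrite (det_similar_affine _ _ hS) det_Jord_affine horner_prod.
apply: eq_bigr => i _; rewrite horner_exp; congr (_ ^+ _).
by rewrite !hornerE mulrC.
Qed.

End FinalFacts.

Theorem mainTheorem3 (R : realType) (TF : transfer_function R)
  (n : nat) (l0 : R)
  (A : 'M[R]_n) (B : 'cV[R]_n) (C : 'rV[R]_n) (D : R) (E : 'M[R]_n)
  (nu alpha gamma : nat) (n_ : 'I_alpha -> nat)
  (mu : 'I_alpha -> Cbar R) (z : 'I_gamma -> Cbar R)
  (S : 'M[R]_nu) (L : 'rV[R]_nu) (Pi : 'M[R]_(n, nu))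
  (Sz : 'M[R]_gamma) (Rz : 'cV[R]_gamma)
  (hmin : minimal_centred_realisation (Some (ofR l0)) A B C D E TF)
  (hn : n = mcmillan_degree TF)
  (hl0 : ~~ is_pole TF (ofR l0))
  (hnu : (0 < nu < n)%N)
  (halpha : (0 < alpha)%N)
  (hn_ : forall i, (0 < n_ i)%N)
  (hsum : (\sum_(i < alpha) n_ i)%N = nu)
  (hgamma : (gamma <= nu)%N)
  (hmu0 : forall i, mu i <> Some (ofR l0))
  (hz0 : forall l, z l <> Some (ofR l0))
  (hmu_inj : injective mu)
  (hz_inj : injective z)
  (hmuz : forall i l, mu i <> z l)
  (hmuE : forall i, ~~ gen_eigenvalue (ofRmx A) (ofRmx E) (mu i))
  (hzE : forall l, ~~ gen_eigenvalue (ofRmx A) (ofRmx E) (z l))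
  (hmoment : exists (i : 'I_alpha) (j : nat),
     (j < n_ i)%N /\ moment (tf_eval TF) j (mu i) != 0)
  (hS : mx_similar (ofRmx S) (Jord (fun i => mobius_val (ofR l0) (mu i)) n_))
  (hLS : observable L S)
  (hPi : E *m Pi + B *m L = (A - l0 *: E) *m Pi *m S)
  (hSz : mx_similar (ofRmx Sz) (diag_mx (\row_l mobius_val (ofR l0) (z l))))
  (hSzRz : controllable Sz Rz) :
  ((exists Pih : 'M[R]_(nu, n), Pih *m Pi = 1%:M) /\
   (forall Pih : 'M[R]_(nu, n), Pih *m Pi = 1%:M ->
      exists! Uz : 'M[R]_(gamma, n),
        Sz *m Uz *m (A - l0 *: E) = Uz *m E + Rz *m (C + D *: (L *m Pih)))) /\
  (forall (Pih : 'M[R]_(nu, n)) (Uz : 'M[R]_(gamma, n)) (G : 'cV[R]_nu),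
     Pih *m Pi = 1%:M ->
     Sz *m Uz *m (A - l0 *: E) = Uz *m E + Rz *m (C + D *: (L *m Pih)) ->
     \rank (Uz *m (A - l0 *: E) *m Pi) = gamma ->
     Uz *m B = 0 ->
     (forall i, ~~ gen_eigenvalue (ofRmx (S - G *m L)) 1%:M
                     (mobius (ofR l0) (mu i))) ->
     Uz *m (A - l0 *: E) *m Pi *m G + D *: Rz = 0 ->
     let Am : 'M[R]_nu := 1%:M + l0 *: (S - G *m L) in
     let Bm : 'cV[R]_nu := G in
     let Cm : 'rV[R]_nu := C *m Pi in
     let Dm : R := D in
     let Em : 'M[R]_nu := S - G *m L in
     let H := centred_tf (Some (ofR l0)) Am Bm Cm Dm Em in
     let M := ofRmx (sys_const l0 Am Bm Cm Dm) in
     let N := ofRmx (sys_lin Bm Em) in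
     [/\ regular_pencil Am Em,
         (forall (i : 'I_alpha) (j : nat), (j < n_ i)%N ->
            moment (tf_eval TF) j (mu i) = moment H j (mu i)),
         (forall l : 'I_gamma, z l <> None -> gen_eigenvalue M N (z l)) &
         (forall l : 'I_gamma, z l = None ->
            exists infs : seq nat,
              inf_partial_multiplicities M N infs /\
              exists2 k : nat, k \in infs & (1 < k)%N)]).
Proof.
move: (hmin) (hnu) => [hr _] /andP[nu0 nun].
have [reg _] := hr; have regc := regular_pencil_ofRmx reg.
have d10 := realisation_den_neq0 hr; have id1 := realisation_identity hr.
have tfE := tf_eval_fraction hr.
have co := tf_poly_coprime TF; have den0 := tf_poly_den_neq0 TF.
have snu : (nu < maxn (size (tf_poly (tf_num TF))) (size (tf_poly (tf_den TF))))%N.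
  rewrite !size_tf_poly; have : (0 < size (tf_den TF))%N.
    by rewrite size_poly_gt0 tf_den_neq0.
  by move: nun; rewrite hn /mcmillan_degree; lia.
have hPic : ofRmx E *m ofRmx Pi + ofRmx B *m ofRmx L =
    (ofRmx A - ofR l0 *: ofRmx E) *m ofRmx Pi *m ofRmx S.
  by rewrite -ofRmxZ -ofRmxB -!ofRmxM -ofRmxD hPi.
have [Q Qu QS] := similar_diag_left_eigenvectors hSz.
have thE l : (\row_l mobius_val (ofR l0) (z l)) 0 l = mobius_val (ofR l0) (z l).
  by rewrite mxE.
have {thE}QS l : row l Q *m ofRmx Sz = mobius_val (ofR l0) (z l) *: row l Q.
  by rewrite QS thE.
have thS (t : Cbar R) x : t <> Some (ofR l0) -> t = Some x ->
    mobius (ofR l0) t = Some (x - ofR l0)^-1 /\ x - ofR l0 != 0.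
  move=> + tx; rewrite tx => xl; have xl0 : x != ofR l0 by apply: contra_notN xl => /eqP ->.
  by rewrite /= (negbTE xl0) subr_eq0.
split; first split.
- have full : row_full Pi.
    rewrite /row_full -rank_ofRmx; apply: row_full_of_inj => x Px.
    apply: (observable_ofRmx hLS).
    exact: (sylvester_kernel hPic d10 co den0 id1 snu Px).
  by exists (pinvmx Pi); rewrite mulVpmx.
- move=> Pih _; pose f := (mulmxr (A - l0 *: E) \o mulmx Sz) \- mulmxr E.
  have fE U : f U = Sz *m U *m (A - l0 *: E) - U *m E by [].
  have inj (U : 'M[R]_(gamma, n)) : f U = 0 -> U = 0.
    rewrite fE => /eqP; rewrite subr_eq0 => /eqP hU; apply: ofRmx_inj; rewrite ofRmx0.
    have {}hU : ofRmx Sz *m ofRmx U *m (ofRmx A - ofR l0 *: ofRmx E) =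
                ofRmx U *m ofRmx E by rewrite -ofRmxZ -ofRmxB -!ofRmxM hU.
    (* The rows of [Q] are left eigenvectors of [Sz], which decouples the equation: [v E] is the
       Moebius value of [z l] times [v (A - l0 E)]. This amounts to [v (A - x E) = 0] for [z l = x],
       or to [v E = 0] at infinity, and [z l] is no generalised eigenvalue. *)
    apply: (can_inj (mulKmx Qu)); rewrite mulmx0; apply/row_matrixP=> l.
    rewrite row_mul row0; set v := row l Q *m ofRmx U.
    have vE : v *m ofRmx E =
        mobius_val (ofR l0) (z l) *: (v *m (ofRmx A - ofR l0 *: ofRmx E)).
      by rewrite /v -mulmxA -hU !mulmxA QS -!scalemxAl.
    have := not_gen_eigenvalue_unit regc (hzE l).
    case Ez: (z l) => [x|] u; move: vE; rewrite /mobius_val; last first.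
      by rewrite Ez /= scale0r => vE; rewrite -[v](mulmxK u) vE mul0mx.
    have [-> x0] := thS _ _ (hz0 l) Ez => /= vE.
    rewrite -[v](mulmxK u); suff -> : v *m (ofRmx A - x *: ofRmx E) = 0 by rewrite mul0mx.
    have -> : ofRmx A - x *: ofRmx E =
        (ofRmx A - ofR l0 *: ofRmx E) - (x - ofR l0) *: ofRmx E.
      by rewrite scalerBl opprB addrA subrK.
    by rewrite mulmxBr -scalemxAr vE scalerA mulfV // scale1r subrr.
  have [U [fU Uu]] := linear_inj_surj inj (Rz *m (C + D *: (L *m Pih))).
  exists U; split; first by apply/eqP; rewrite [X in _ == X]addrC -subr_eq; apply/eqP; exact: fU.
  by move=> V hV; apply: Uu; rewrite [LHS]fE hV addrAC subrr add0r.
move=> Pih Uz G hPih hUz _ hUB hG hYG Am Bm Cm Dm Em H M N.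
set Y := Uz *m (A - l0 *: E) *m Pi in hYG.
(* [Uz B = 0] removes [B L] from [Uz E Pi], leaving [Y S]; [Pih Pi = 1] reduces the feedthrough term
   to [D Rz L], which equals [- Y G L] and turns [Y S] into [Y Em]. *)
have SzY : Sz *m Y = Y *m Em + Rz *m Cm.
  have EPi : Uz *m E *m Pi = Y *m S.
    rewrite -mulmxA (_ : E *m Pi = (A - l0 *: E) *m Pi *m S - B *m L).
      by rewrite mulmxBr [Uz *m (B *m L)]mulmxA hUB mul0mx subr0 /Y !mulmxA.
    by rewrite -hPi addrK.
  have YG : Y *m G = - (D *: Rz) by apply/eqP; rewrite -addr_eq0 hYG.
  rewrite /Y !mulmxA hUz mulmxDl EPi /Em mulmxBr [Y *m (G *m L)]mulmxA YG.
  rewrite -addrA; congr (_ + _).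
  rewrite -mulmxA mulmxDl -scalemxAl -[L *m Pih *m Pi]mulmxA hPih mulmx1.
  by rewrite mulmxDr -scalemxAr mulNmx opprK addrC mulmxA -scalemxAl.
have SzYc : ofRmx Sz *m ofRmx Y = ofRmx Y *m ofRmx Em + ofRmx Rz *m ofRmx Cm.
  by rewrite -!ofRmxM SzY ofRmxD.
have YGc : ofRmx Y *m ofRmx G + ofR D *: ofRmx Rz = 0.
  by rewrite -ofRmxM -ofRmxZ -ofRmxD hYG ofRmx0.
have Emc : ofRmx Em = ofRmx S - ofRmx G *m ofRmx L by rewrite ofRmxB ofRmxM.
have Amc : ofRmx Am = 1%:M + ofR l0 *: ofRmx Em by rewrite ofRmxD ofRmx1 ofRmxZ.
have Cmc : ofRmx Cm = ofRmx C *m ofRmx Pi by rewrite ofRmxM.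
pose d1 := centred_den (ofRmx A) (ofRmx E).
pose d2 := centred_den (ofRmx Am) (ofRmx Em).
pose p1 := centred_num (ofR l0) (ofRmx A) (ofRmx B) (ofRmx C) (ofR D) (ofRmx E).
pose p2 := centred_num (ofR l0) (ofRmx Am) (ofRmx Bm) (ofRmx Cm) (ofR Dm) (ofRmx Em).
have HE y : d2.[y] != 0 -> H y = p2.[y] / d2.[y] by exact: centred_tf_fraction.
(* At a finite [x], [x Em - Am] is [(x - l0)] times [Em - (x - l0)^-1]; at infinity the Moebius
   value is 0, so the condition on [G] makes [Em] itself invertible and the degree full. *)
have hmu i : regular_at n nu d1 d2 (mu i).
  have reg1 : regular_pencil (ofRmx Em) (1%:M : 'M[cplx R]_nu).
    apply/regular_pencilE; rewrite -size_poly_gt0 size_det_lpencil //.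
    exact: unitmx1.
  have u1 := not_gen_eigenvalue_unit regc (hmuE i).
  have u2 := not_gen_eigenvalue_unit reg1 (hG i).
  case Emu: (mu i) u1 u2 => [x|]; last first.
    move=> u1; rewrite /= scale0r subr0 => u2.
    by rewrite /d1 /d2 /centred_den !size_det_lpencil.
  have [xm x0] := thS _ _ (hmu0 i) Emu.
  move=> u1; rewrite -Emu xm => u2; rewrite Emu /regular_at !centred_den_horner -!unitfE -!unitmxE.
  rewrite -opprB -scaleN1r unitmxZ ?unitrN1 // u1; split=> //.
  have -> : x *: ofRmx Em - ofRmx Am =
      (x - ofR l0) *: (ofRmx Em - (x - ofR l0)^-1 *: 1%:M).
    by rewrite Amc scalerBr scalerA mulfV // scale1r scalerBl opprD addrA addrAC.
  by rewrite unitmxZ // unitfE.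
have hmoments (i : 'I_alpha) (j : nat) : (j < n_ i)%N ->
    moment (tf_eval TF) j (mu i) = moment H j (mu i).
  move=> jn.
  pose x := (map_mx polyC (ofRmx C) *m \adj (lpencil (ofRmx E) (ofRmx A)) *m
    map_mx polyC (ofRmx B - (ofRmx A - ofR l0 *: ofRmx E) *m ofRmx Pi *m ofRmx G)) 0 0.
  have Dl : p1 * d2 - p2 * d1 = ((ofR l0)%:P - 'X) * x *
      \prod_i (mobius_val (ofR l0) (mu i) *: ('X - (ofR l0)%:P) - 1) ^+ n_ i.
    rewrite -(signal_den_prod (ofR l0) hS) /p1 /p2 /d1 /d2 Amc Cmc Emc.
    exact: fraction_difference hPic d10 _.
  have sx : (size x <= n)%N.
    apply: size_mulmx_constr => a b; apply: size_mulmx_const => a' b'.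
    by apply: size_adj => a'' b''; apply: size_lpencil.
  have s1 : (size p1 <= n.+1)%N by apply: size_centred_num.
  have s2 : (size p2 <= nu.+1)%N by apply: size_centred_num.
  exact: (moment_contact tfE HE Dl hsum sx s1 s2 (hmu0 i) (hmu i) jn).
have ME : M = block_mx (1%:M + ofR l0 *: ofRmx Em) (ofR l0 *: ofRmx G) (ofRmx Cm) (ofR D)%:M.
  by rewrite -Amc -ofRmxZ /M /sys_const /ofRmx map_block_mx map_scalar_mx.
have NE : N = block_mx (ofRmx Em) (ofRmx G) 0 0.
  by rewrite /N /sys_lin /ofRmx map_block_mx !map_mx0.
have [c cu] : exists c, M - c *: N \in unitmx.
  apply: contrapT => nu_.
  have p20 : p2 * d2 = 0.
    apply: (@poly_eq0_cofinite _ _ 1); first exact: oner_neq0.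
    move=> y _; apply/eqP/negPn/negP => pd; apply: nu_; exists y.
    move: pd; rewrite hornerM mulf_eq0 negb_or => /andP[py dy].
    have u2 : y *: ofRmx Em - ofRmx Am \in unitmx.
      by rewrite unitmxE unitfE -centred_den_horner.
    have u2' : ofRmx Am - y *: ofRmx Em \in unitmx.
      by rewrite -opprB -scaleN1r unitmxZ ?unitrN1.
    have -> : M - y *: N = block_mx (ofRmx Am - y *: ofRmx Em)
        ((ofR l0 - y) *: ofRmx G) (ofRmx Cm) (ofR D)%:M.
      rewrite ME NE -Amc scale_block_mx opp_block_mx add_block_mx !scaler0 !oppr0 !addr0.
      by rewrite scalerBl.
    (* The Schur complement is the value [H(y)], nonzero since [p2.[y] != 0]. *)
    rewrite unitmxE det_schur // unitfE mulf_neq0 //.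
    have := py; rewrite centred_num_horner // mulf_eq0 negb_or => /andP[_].
    have -> : invmx (y *: ofRmx Em - ofRmx Am) = - invmx (ofRmx Am - y *: ofRmx Em).
      apply: (can_inj (mulKmx u2)); rewrite mulmxV //.
      by rewrite -opprB mulmxN mulNmx opprK mulmxV.
    rewrite mulmxN mulNmx -scalemxAr; move: (_ *m _ *m _) => K.
    by rewrite !mxE eqxx mulr1n mulNr mulrC addrC.
  have d20 : d2 != 0 by rewrite /d2 Amc; apply: regular_det.
  move/eqP: p20; rewrite mulf_eq0 (negbTE d20) orbF => /eqP p20.
  have [i [j [jn]]] := hmoment; rewrite hmoments // => /eqP; apply.
  apply: (@moment_num0 R nu d2 H) => [y dy|]; first by rewrite HE // p20 horner0 mul0r.
  by have := hmu i; case: (mu i) => [x|] [_] // ->.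
have regMN : regular_pencil M N.
  apply/eqP => /(congr1 (horner^~ c)); rewrite /= horner0 horner_det.
  have -> : mxeval c (pencil_mx M N) = M - c *: N.
    by apply/matrixP=> i j; rewrite !mxE /horner_eval !hornerE.
  by move/eqP; apply/negP; rewrite -unitfE -unitmxE.
have wR l : row l Q *m ofRmx Rz != 0.
  exact: (eigenvector_input_neq0 (controllable_ofRmx hSzRz) (QS l) (row_unitmx_neq0 l Qu)).
split.
- by apply/regular_pencilE; apply: regular_det.
- exact: hmoments.
- move=> l; case Ez: (z l) => [x|] // _; have [xm x0] := thS _ _ (hz0 l) Ez.
  have th : (x - ofR l0) * mobius_val (ofR l0) (z l) = 1.
    by rewrite /mobius_val xm /= mulfV.
  have K0 := zero_left_kernel SzYc YGc th (QS l).
  rewrite -ME -NE in K0; apply: (left_kernel_gen_eigenvalue regMN _ K0).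
  apply/eqP; rewrite -row_mx0 => /eq_row_mx[_ /eqP].
  by rewrite scaler_eq0 oppr_eq0 (negbTE x0) (negbTE (wR l)).
- move=> l Ez; have wS : row l Q *m ofRmx Sz = 0 by rewrite QS Ez /mobius_val /= scale0r.
  have [h0 h1] := infinite_zero_chain (ofR l0) SzYc YGc wS.
  rewrite -ME -NE in h0 h1; apply: (regular_pencil_infinite_chain cu h0 h1).
  apply/eqP; rewrite -row_mx0 => /eq_row_mx[_ /eqP].
  by rewrite oppr_eq0 (negbTE (wR l)).
Qed.
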